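(* Let $\widetilde{H} \subset L$ be a light-cone regular domain and suppose that the equation $f_h = \Phi(f_{h+v_1},\ldots,f_{h+v_N})$ ($h \in L$) has the Laurent property, the irreducibility and the coprimeness on $\widetilde{H}$. Then for every light-cone regular domain $H \subset L$, the equation has the Laurent property, the irreducibility and the coprimeness on $H$.
   Context: Let $R$ be a unique factorization domain with field of fractions $K$. Let $L$ be a finitely generated $\mathbb{Z}$-module (possibly with torsion). Fix distinct $v_1,\dots,v_N\in L$ which generate $L$ as a $\mathbb{Z}$-module and are linearly independent over $\mathbb{Z}_{\ge 0}$ (i.e. $\sum_i a_i v_i=0$ with all $a_i\in\mathbb{Z}_{\ge0}$ forces $a_1=\dots=a_N=0$), and an irreducible Laurent polynomial $\Phi\in R[Y_1^{\pm1},\dots,Y_N^{\pm1}]$ which is not a Laurent monomial and depends on every variable $Y_1,\dots,Y_N$. Consider the equation $f_h=\Phi(f_{h+v_1},\dots,f_{h+v_N})$ ($h\in L$). Let $S=\{\sum_i a_iv_i : a_i\in\mathbb{Z}_{\ge0}\}$ and define the partial order $h_1\le h_2$ iff $h_1-h_2\in S$. Assume further that $v_N$ is the minimum of $\{0,v_1,\dots,v_N\}$ with respect to $\le$ and that the equation can be solved as $f_{h+v_N}=\Psi(f_{h+v_1},\dots,f_{h+v_{N-1}},f_h)$ with $\Psi$ an irreducible Laurent polynomial with coefficients in $R$. A nonempty subset $H\subset L$ is light-cone regular if for every $h\in H$ the set $\{h'\in H: h'\le h\}$ is finite and $\{h'\in L: h'\ge h\}\subset H$. Its initial boundary is $H_0=\{h\in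 H:\ h+v_i\notin H\text{ for some }i\}$. For such $H$, the $f_{h}$ ($h\in H_0$) are algebraically independent indeterminates over $K$ (the initial variables), and for $h\in H\setminus H_0$ (where all $h+v_i\in H$) the value $f_h$ is defined recursively by the equation as an element of the rational function field $K(f_{h_0}: h_0\in H_0)$. For $T\subset L$ write $R_T=R[f_h^{\pm1}: h\in T]$ and $K_T=K[f_h^{\pm1}: h\in T]$. The equation has the Laurent property on $H$ if $f_h\in R_{H_0}$ for all $h\in H$; assuming the Laurent property, it has the irreducibility on $H$ if every $f_h$ ($h\in H$) is irreducible in $R_{H_0}$ (by convention, units are counted as irreducible), and the coprimeness on $H$ if $f_{h_1}$ and $f_{h_2}$ are coprime in $R_{H_0}$ for all $h_1\neq h_2$ in $H$. *)

(* Defs.v *)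
From HB Require Import structures.
From mathcomp Require Import all_boot all_order all_algebra.
From mathcomp Require Import fraction.
From mathcomp.multinomials Require Import mpoly.

Set Implicit Arguments.
Unset Strict Implicit.
Unset Printing Implicit Defensive.

Import Order.TTheory GRing.Theory Num.Theory.
Local Open Scope ring_scope.

Notation "x %:F" := (@FracField.tofrac _ x) : ring_scope.

Section InSubring.
Variable T : comNzRingType.
Variable S : T -> Prop.

Definition unit_in (a : T) : Prop := S a /\ exists b, S b /\ a * b = 1.

Definition dvd_in (a b : T) : Prop := exists c, S c /\ b = a * c.

(* Irreducible in S, with the paper's convention that units count as
   irreducible: a nonzero element of S all of whose factorizations in S
   are trivial. *)
Definition irreducible_in (a : T) : Prop :=
  S a /\ a != 0 /\
  forall b c, S b -> S c -> a = b * c -> unit_in b \/ unit_in c.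

Definition coprime_in (a b : T) : Prop :=
  S a /\ S b /\
  forall d, S d -> dvd_in d a -> dvd_in d b -> unit_in d.
End InSubring.

Section UFD.
Variable R : idomainType.

Definition irreducible_elt (a : R) : Prop :=
  a != 0 /\ a \isn't a GRing.unit /\
  forall b c, a = b * c -> b \is a GRing.unit \/ c \is a GRing.unit.

Definition associated (a b : R) : Prop :=
  exists u, u \is a GRing.unit /\ a = u * b.

Definition UFD : Prop :=
  (forall a : R, a != 0 -> a \isn't a GRing.unit ->
     exists s : seq R, (forall p, p \in s -> irreducible_elt p) /\
                       a = \prod_(p <- s) p)
  /\
  (forall s t : seq R,
     (forall p, p \in s -> irreducible_elt p) ->
     (forall p, p \in t -> irreducible_elt p) ->
     \prod_(p <- s) p = \prod_(p <- t) p ->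
     exists sigma : 'I_(size s) -> 'I_(size t),
       bijective sigma /\
       forall i : 'I_(size s), associated (nth 0 s i) (nth 0 t (sigma i))).
End UFD.

(* Laurent polynomials in finitely many variables, represented as       *)
(* P / Y^m with P a polynomial and m a monomial (exponent vector).     *)

Definition lpeval (k : nat) (R : ringType) (S : unitRingType)
    (f : R -> S) (y : 'I_k -> S) (P : {mpoly R[k]}) (m : 'X_{1..k}) : S :=
  mmap f y P / mmap1 y m.

Section LaurentN.
Variables (R : idomainType) (k : nat).

Local Notation FracN := {fraction {mpoly R[k]}}.

Definition lpfrac (P : {mpoly R[k]}) (m : 'X_{1..k}) : FracN :=
  (P %:F) / (('X_[m] : {mpoly R[k]}) %:F).

Definition laurentN (q : FracN) : Prop :=
  exists P m, q = lpfrac P m.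

Definition laurent_monomial (q : FracN) : Prop :=
  exists (c : R) (a b : 'X_{1..k}),
    q = lpfrac (c *: ('X_[a] : {mpoly R[k]})) b.

(* q depends on the variable Y_i: q does not lie in the Laurent
   subring R[Y_j^{+-1} : j <> i]. *)
Definition depends_on (q : FracN) (i : 'I_k) : Prop :=
  ~ exists P m, q = lpfrac P m /\ m i = 0%N /\
                (forall mo, mo \in msupp P -> mo i = 0%N).
End LaurentN.

(* The lattice L, the shifts v_1..v_N (here N = n.+1, v_N = v ord_max), *)
(* the semigroup S and the partial order.                               *)
Section Lattice.
Variables (L : zmodType) (n : nat) (v : 'I_n.+1 -> L).

Definition generates : Prop :=
  forall h : L, exists a : 'I_n.+1 -> int, h = \sum_(i < n.+1) v i *~ a i.

Definition nonneg_independent : Prop :=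
  forall a : 'I_n.+1 -> nat,
    \sum_(i < n.+1) v i *+ a i = 0 -> forall i, a i = 0%N.

Definition inS (h : L) : Prop :=
  exists a : 'I_n.+1 -> nat, h = \sum_(i < n.+1) v i *+ a i.

Definition lcle (h1 h2 : L) : Prop := inS (h1 - h2).

Definition light_cone_regular (H : L -> Prop) : Prop :=
  (exists h, H h) /\
  (forall h, H h ->
     (exists s : seq L, forall h', H h' -> lcle h' h -> h' \in s) /\
     (forall h', lcle h h' -> H h')).

Definition init_boundary (H : L -> Prop) (h : L) : Prop :=
  H h /\ exists i, ~ H (h + v i).
End Lattice.

(* The ambient field: F is a field extension of K = Frac(R) (via iota), *)
(* containing a family (x_h)_{h in L} algebraically independent over K. *)
(* The initial variable f_h (h in H_0) is x_h.                           *)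
Section Ambient.
Variables (R : idomainType) (F : fieldType)
          (iota : {rmorphism {fraction R} -> F}) (L : zmodType) (x : L -> F).

Definition alg_independent : Prop :=
  forall (k : nat) (hs : 'I_k -> L), injective hs ->
    forall p : {mpoly {fraction R}[k]},
      mmap iota (fun i => x (hs i)) p = 0 -> p = 0.

Definition iotaR (r : R) : F := iota (r %:F).

Definition laurent_ring (T : L -> Prop) (a : F) : Prop :=
  exists (k : nat) (hs : 'I_k -> L) (P : {mpoly R[k]}) (m : 'X_{1..k}),
    (forall i, T (hs i)) /\ a = lpeval iotaR (fun i => x (hs i)) P m.

Variables (n : nat) (v : 'I_n.+1 -> L) (P : {mpoly R[n.+1]})
          (mP : 'X_{1..n.+1}).

Definition is_solution (H : L -> Prop) (f : L -> F) : Prop :=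
  (forall h, init_boundary v H h -> f h = x h) /\
  (forall h, H h -> ~ init_boundary v H h ->
     f h = lpeval iotaR (fun i => f (h + v i)) P mP).

Definition laurent_property (H : L -> Prop) : Prop :=
  forall f, is_solution H f ->
    forall h, H h -> laurent_ring (init_boundary v H) (f h).

Definition irreducibility (H : L -> Prop) : Prop :=
  forall f, is_solution H f ->
    forall h, H h -> irreducible_in (laurent_ring (init_boundary v H)) (f h).

Definition coprimeness (H : L -> Prop) : Prop :=
  forall f, is_solution H f ->
    forall h1 h2, H h1 -> H h2 -> h1 <> h2 ->
      coprime_in (laurent_ring (init_boundary v H)) (f h1) (f h2).
End Ambient.

Section EquationHyps.
Variables (R : idomainType) (n : nat).
Local Notation FracN := {fraction {mpoly R[n.+1]}}.

Definition PhiF (P : {mpoly R[n.+1]}) (mP : 'X_{1..n.+1}) : FracN :=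
  lpfrac P mP.

Definition Phi_hyps (P : {mpoly R[n.+1]}) (mP : 'X_{1..n.+1}) : Prop :=
  irreducible_in (@laurentN R n.+1) (PhiF P mP) /\
  ~ laurent_monomial (PhiF P mP) /\
  forall i, depends_on (PhiF P mP) i.

(* Psi is an irreducible Laurent polynomial with coefficients in R and
   X = Phi(Y_1,...,Y_N) is solved as Y_N = Psi(Y_1,...,Y_{N-1}, X),
   as an identity of rational functions. *)
Definition Psi_hyps (P : {mpoly R[n.+1]}) (mP : 'X_{1..n.+1})
    (Q : {mpoly R[n.+1]}) (mQ : 'X_{1..n.+1}) : Prop :=
  irreducible_in (@laurentN R n.+1) (PhiF Q mQ) /\
  lpeval (fun r : R => (r%:MP : {mpoly R[n.+1]}) %:F)
         (fun i : 'I_n.+1 =>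
            if i == ord_max then PhiF P mP
            else (('X_i : {mpoly R[n.+1]}) %:F))
         Q mQ
  = (('X_ord_max : {mpoly R[n.+1]}) %:F).
End EquationHyps.

(* Main.v *)
(* Work in the values of a solution f on Ht.  Removing from a light-cone regular
   H a minimal point h0 exchanges the initial variable X = f_{h0} for
   W = f_{h0 - v_N}, with W = Phi(..., X) and X = Psi(..., W); so, with
   A = R_{H_0} and B = R_{(H \ h0)_0}, one has A[1/W] = B[1/X].  Both W in A and X in
   B are prime, because Laurent rings over a UFD are factorial.  Hence all three
   properties pass from A to B as soon as X does not divide any f_h in B.  If it
   did, the divisibility would persist after translating the finitely many points
   involved deep into Ht, by a t such that f_{h0 + t} is not a unit in R_{Ht_0}:
   there f_{h0 + t} is a prime dividing a product of values coprime to it.  Such t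
   exist since units are Laurent monomials, while Phi, evaluated at algebraically
   independent monomials, is not one.  Finally, below any given point, H agrees
   with a translate of Ht deprived of finitely many points, and these can be
   removed one at a time. *)

Require Import Defs.
From HB Require Import structures.
From mathcomp Require Import all_boot all_order all_algebra.
From mathcomp Require Import fraction.
From mathcomp.multinomials Require Import mpoly.
From mathcomp Require Import zify ring.
From Stdlib Require Import Classical ClassicalEpsilon.
From Stdlib Require Import FunctionalExtensionality PropExtensionality.

Set Implicit Arguments.
Unset Strict Implicit.
Unset Printing Implicit Defensive.

Import Order.TTheory GRing.Theory Num.Theory.
Local Open Scope ring_scope.

(** * Prime factorization in polynomial rings *)

(** All rings are subrings of the fixed field [F], and one solution [f] serves every domain cut out
    of [Ht]: removing a point only changes which values of [f] count as variables. Their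
    independence has to be proved anew after each removal, and this is where dependence of Phi on
    [Y_N] enters. The main obstacle is the translation by [t]. It is not a ring morphism on [B],
    since [f] is controlled only on [Ht] and the translated variables may be algebraically
    dependent. It is therefore a relation, [corr], between expressions in finitely many variables:
    independence at the source makes it single-valued, and the target values need only be nonzero.
    When the target is independent too, [corr] is an isomorphism, which serves to compare pieces of
    an arbitrary domain with their models inside [Ht]. Primes may be units throughout: a priori X
    could be a unit of [B], and non-divisibility of the values by X excludes this as well. *)

Section Factorial.
Variable C : idomainType.

(* Units are allowed, so that factoriality needs no separate treatment of them. *)
Definition qprime (p : C) : Prop :=
  p != 0 /\ forall a b c, a * b = p * c ->
    (exists d, a = p * d) \/ (exists d, b = p * d).

Definition is_factorial : Prop :=
  forall a : C, a != 0 -> exists2 s : seq C, (forall p, p \in s -> qprime p)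
                                           & a = \prod_(p <- s) p.

Lemma qprime_unit (u : C) : u \is a GRing.unit -> qprime u.
Proof.
move=> uU; split; first by apply: contraTneq uU => ->; rewrite unitr0.
by move=> a b c _; left; exists (u^-1 * a); rewrite mulrA divrr // mul1r.
Qed.

Lemma qprime_dvd_prod (p : C) (s : seq C) c :
  qprime p -> p \isn't a GRing.unit -> \prod_(q <- s) q = p * c ->
  exists2 q, q \in s & exists d, q = p * d.
Proof.
case=> p0 pp pN; elim: s c => [|q s IH] c.
  by rewrite big_nil => /esym/eqP pc; case/negP: pN; apply/unitrPr; exists c; apply/eqP.
rewrite big_cons => /pp; case=> [[d ->]|[d /IH [r rs hr]]].
  by exists (p * d); [rewrite mem_head|exists d].
by exists r; rewrite // in_cons rs orbT.
Qed.
End Factorial.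

(** Compare a factorization of [p * c] with one of [a * b]: uniqueness matches the entry standing
    for [p] with an irreducible factor of [a] or of [b], up to a unit. *)
Lemma UFD_irreducible_qprime (C : idomainType) (p : C) :
  UFD C -> irreducible_elt p -> qprime p.
Proof.
case=> ex un [p0 [pN pirr]]; split=> // a b c abpc.
have [a0|a0] := eqVneq a 0; first by left; exists 0; rewrite mulr0.
have [b0|b0] := eqVneq b 0; first by right; exists 0; rewrite mulr0.
have [aU|aN] := boolP (a \is a GRing.unit).
  by right; exists (a^-1 * c); rewrite mulrCA -abpc mulKr.
have [bU|bN] := boolP (b \is a GRing.unit).
  by left; exists (c / b); rewrite mulrA -abpc mulrK.
have [sa [sai ea]] := ex a a0 aN.
have [sb [sbi eb]] := ex b b0 bN.
(* The list [t] starts with an associate of [p]: a unit [c] is absorbed into that entry, otherwise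
   [p] is put in front of the factors of [c]. *)
have [t [u [ti uU t0 sz e1]]] : exists (t : seq C) (u : C),
    [/\ forall q, q \in t -> irreducible_elt q, u \is a GRing.unit,
        nth 0 t 0 = u * p, (0 < size t)%N & \prod_(q <- t) q = a * b].
  have c0 : c != 0.
    by apply: contraNneq (mulf_neq0 a0 b0) => c0; rewrite abpc c0 mulr0.
  have [cU|cN] := boolP (c \is a GRing.unit).
    exists [:: p * c], c; split=> //; [|exact: mulrC|by rewrite big_seq1].
    move=> q; rewrite inE => /eqP ->; split; first by rewrite mulf_neq0.
    split; first by rewrite unitrM (negbTE pN).
    move=> x y pcxy; have : p = x * (y / c) by rewrite mulrA -pcxy mulrK.
    case/pirr=> [|]; first by left.
    by rewrite unitrM => /andP [yU _]; right.
  have [sc [sci ec]] := ex c c0 cN.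
  exists (p :: sc), 1; split; rewrite ?unitr1 ?mul1r //.
    by move=> q; rewrite inE => /orP [/eqP ->|/sci].
  by rewrite big_cons -ec.
have sabi q : q \in sa ++ sb -> irreducible_elt q.
  by rewrite mem_cat => /orP [/sai|/sbi].
have eab : \prod_(q <- t) q = \prod_(q <- sa ++ sb) q by rewrite big_cat /= -ea -eb.
have [sg [_ /(_ (Ordinal sz)) [w [wU]]]] := un t _ ti sabi eab.
rewrite /= t0; set q := nth _ _ _ => epq.
have qE : q = p * (w^-1 * u).
  by rewrite mulrCA [p * u]mulrC epq mulKr.
have : q \in sa ++ sb by apply: mem_nth.
rewrite mem_cat => /orP [] qin; [left; rewrite ea|right; rewrite eb].
all: by rewrite (big_rem q) //= qE -mulrA; eexists.
Qed.

Lemma UFD_factorial (C : idomainType) : UFD C -> is_factorial C.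
Proof.
move=> ufd a a0; have [aU|aN] := boolP (a \is a GRing.unit).
  exists [:: a]; last by rewrite big_seq1.
  by move=> p; rewrite inE => /eqP ->; apply: qprime_unit.
have [s [si ->]] := ufd.1 a a0 aN.
by exists s => // p /si; apply: UFD_irreducible_qprime.
Qed.

Section PolyFactorial.
Variable C : idomainType.
Hypothesis facC : is_factorial C.

Lemma dvd_polyC_coef (c : C) (f : {poly C}) :
  (exists g, f = c%:P * g) <-> (forall i, exists d, f`_i = c * d).
Proof.
split=> [[g ->] i|h]; first by rewrite coefCM; eexists.
pose d i := proj1_sig (constructive_indefinite_description _ (h i)).
exists (\poly_(i < size f) d i); apply/polyP=> i.
rewrite coefCM coef_poly; case: ltnP => hi; last by rewrite mulr0 nth_default.
exact: (proj2_sig (constructive_indefinite_description _ (h i))).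
Qed.

(** Gauss's argument: if [p] divides neither polynomial, take in each the first coefficient, of
    index [i] and [j], not divisible by [p]. In coefficient [i + j] of the product all other terms
    are multiples of [p], so [p] divides the product of these two. *)
Lemma qprime_polyC (p : C) : qprime p -> qprime p%:P.
Proof.
case=> p0 pp; split; first by rewrite polyC_eq0.
move=> a b c abpc; apply: NNPP => /not_or_and [/dvd_polyC_coef na /dvd_polyC_coef nb].
pose bad (f : {poly C}) i := ~ exists d, f`_i = p * d.
have minbad (f : {poly C}) : ~ (forall i, exists d, f`_i = p * d) ->
    exists2 i, bad f i & forall j, (j < i)%N -> exists d, f`_j = p * d.
  move=> /not_all_ex_not [i]; elim/ltn_ind: i => i IH bi.
  case: (classic (exists2 j, (j < i)%N & bad f j)) => [[j ji bj]|nj].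
    exact: (IH j).
  exists i => // j ji; apply: NNPP => bj; apply: nj; by exists j.
have [i bi mi] := minbad _ na; have [j bj mj] := minbad _ nb.
have : exists d, a`_i * b`_j = p * d.
  have := congr1 (fun f : {poly C} => f`_(i + j)) abpc.
  rewrite coefM coefCM (bigD1 (inord i : 'I_(i + j).+1)) //=.
  rewrite inordK ?ltnS ?leq_addr // addKn => e.
  have [d ed] : exists d, \sum_(k < (i + j).+1 | k != inord i) a`_k * b`_(i + j - k) = p * d.
    apply: (big_ind (fun z => exists d, z = p * d)).
    - by exists 0; rewrite mulr0.
    - by move=> _ _ [d ->] [d' ->]; exists (d + d'); rewrite mulrDr.
    move=> k ki; have ki' : k != i :> nat.
      by apply: contraNneq ki => ki; apply/eqP/val_inj; rewrite /= inordK ?ltnS ?leq_addr.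
    case: (ltnP k i) => [/mi [d ->]|ik]; first by exists (d * b`_(i + j - k)); rewrite mulrA.
    have /mj [d ->] : (i + j - k < j)%N.
      by rewrite ltn_subLR ?ltn_add2r ?ltn_neqAle 1?eq_sym ?ki' // -ltnS.
    by exists (a`_k * d); rewrite mulrCA.
  by exists (c`_(i + j) - d); rewrite mulrBr -ed -e addrK.
by case=> d /pp [[e ee]|[e ee]]; [apply: bi|apply: bj]; exists e.
Qed.

Definition primitive (f : {poly C}) : Prop :=
  forall c g, f = c%:P * g -> c \is a GRing.unit.

(** Constants are divided out one prime at a time. Such a prime divides the leading coefficient,
    hence is associated to an entry of its factorization [s]; that entry is deleted, so the length
    of [s] bounds the number of divisions. *)
Lemma primitive_part (f : {poly C}) :
  f != 0 -> exists c g, f = c%:P * g /\ primitive g.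
Proof.
move=> f0; have lf0 : lead_coef f != 0 by rewrite lead_coef_eq0.
have [s si es] := facC lf0.
have : exists2 u, u \is a GRing.unit & lead_coef f = u * \prod_(p <- s) p.
  by exists 1; rewrite ?unitr1 ?mul1r.
elim/ltn_ind: {s}(size s) {-2}s (erefl (size s)) si f f0 {lf0 es}
  => k IH s sk si f f0 [u uU ef].
case: (classic (primitive f)) => [pf|]; first by exists 1, f; rewrite mul1r.
move=> /not_all_ex_not [c /not_all_ex_not [g ncg]].
have [fcg cN] := imply_to_and _ _ ncg.
have c0 : c != 0 by apply: contraNneq f0 => c0; rewrite fcg c0 mul0r.
have [t ti ec] := facC c0.
have [p pt /negP pN] : exists2 p, p \in t & ~ p \is a GRing.unit.
  apply: NNPP => nt; apply: cN; rewrite ec.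
  elim: t ti {ec} nt => [|p t IHt] ti nt; first by rewrite big_nil unitr1.
  rewrite big_cons unitrM; apply/andP; split.
    by apply/negP => pN; apply: nt; exists p; rewrite ?mem_head.
  apply: IHt => [q qt|[q qt qN]].
    by apply: ti; rewrite in_cons qt orbT.
  by apply: nt; exists q; rewrite // in_cons qt orbT.
have pq := ti p pt; have p0 := pq.1.
have {fcg} [h fph] : exists h, f = p%:P * h.
  exists ((\prod_(q <- rem p t) q)%:P * g).
  by rewrite fcg ec (big_rem p) //= polyCM mulrA.
have els : \prod_(q <- s) q = p * (u^-1 * lead_coef h).
  rewrite mulrCA; apply: (mulrI uU); rewrite mulVKr // -ef fph.
  by rewrite lead_coefM lead_coefC.
have [q qs [d qpd]] := qprime_dvd_prod pq pN els.
(* The prime [q = p * d] divides [p] or [d]; in the second case [p] would be a unit. *)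
have dU : d \is a GRing.unit.
  have [q0 qq] := si q qs.
  have d0 : d != 0 by apply: contraNneq q0 => d0; rewrite qpd d0 mulr0.
  case: (qq p d 1); first by rewrite mulr1.
    case=> e pe; apply/unitrPr; exists e; apply: (mulfI p0).
    by rewrite mulrA -qpd -pe mulr1.
  case=> e de; case/negP: pN; apply/unitrPr; exists e; apply: (mulfI d0).
  by rewrite mulrCA mulrA -qpd -de mulr1.
have h0 : h != 0 by apply: contraNneq f0 => h0; rewrite fph h0 mulr0.
have sz : (size (rem q s) < k)%N.
  by rewrite size_rem // -sk prednK //; case: s qs {sk si ef els}.
have [||c' [g' [eh pg']]] := IH _ sz (rem q s) erefl _ h h0.
- by move=> r /mem_rem; apply: si.
- exists (u * d); first by rewrite unitrM uU.
  apply: (mulfI p0); rewrite -[p in LHS](lead_coefC p) -lead_coefM -fph ef.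
  by rewrite (big_rem q) //= qpd; rewrite mulrCA -!mulrA; congr (_ * _); rewrite mulrCA.
by exists (p * c'), g'; rewrite polyCM -mulrA -eh.
Qed.

(** The primes of [c] are removed one by one: each divides [f * h], and one that divides [f] is a
    unit by primitivity, so [h] is divisible in either case. *)
Lemma primitive_cancel (f g h : {poly C}) (c : C) :
  primitive f -> c != 0 -> c%:P * g = f * h -> exists h', h = c%:P * h'.
Proof.
move=> pf /facC [s si ->]; elim: s si h => [|p s IH] si h.
  by rewrite big_nil => _; exists h; rewrite mul1r.
have pq : qprime p by apply: si; rewrite mem_head.
rewrite big_cons polyCM -mulrA => e.
have [h1 eh] : exists h1, h = p%:P * h1.
  case: ((qprime_polyC pq).2 _ _ _ (esym e)) => // - [d /pf pU].
  by exists (p^-1%:P * h); rewrite mulrA -polyCM divrr // mul1r.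
have p0 : p%:P != 0 by rewrite polyC_eq0; exact: pq.1.
have [h2 eh1] : exists h2, h1 = (\prod_(j <- s) j)%:P * h2.
  apply: IH => [q qs|]; first by apply: si; rewrite in_cons qs orbT.
  by apply: (mulfI p0); rewrite e eh mulrCA.
by exists h2; rewrite eh eh1 mulrA -polyCM.
Qed.

(** [%|] on [{poly C}] is divisibility up to a nonzero constant, that is, over the fraction field;
    primitivity of [f] lets this constant be cancelled. *)
Lemma primitive_dvd (f g : {poly C}) :
  primitive f -> (f %| g)%R -> exists h, g = f * h.
Proof.
move=> pf /Pdiv.Idomain.dvdpP [[c q] /= c0 e].
have [|h eh] := @primitive_cancel f g q c pf c0; first by rewrite mul_polyC e mulrC.
exists h; have c0' : c%:P != 0 :> {poly C} by rewrite polyC_eq0.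
by apply: (mulfI c0'); rewrite mul_polyC e eh mulrCA mulrC mulrA.
Qed.

Lemma qprime_primitive_irreducible (f : {poly C}) :
  primitive f -> irreducible_poly f -> qprime f.
Proof.
move=> pf fi; split; first exact: irredp_neq0 fi.
move=> a b c e.
have : (f %| a * b)%R by rewrite e dvdp_mulr.
case: (boolP (coprimep f a)) => [co|].
  by rewrite Gauss_dvdpr // => /(primitive_dvd pf); right.
move=> nco _; left; apply: (primitive_dvd pf).
have gN : size (gcdp f a) != 1%N by rewrite -coprimep_def.
have := fi.2 _ gN (dvdp_gcdl f a).
by move=> ef; rewrite -(eqp_dvdl _ ef) dvdp_gcdr.
Qed.

(** The content is factored in [C]. If the primitive part is reducible over the fraction field, a
    divisor is replaced by its own primitive part [q'], which divides in [{poly C}], and both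
    factors have smaller degree. *)
Lemma poly_factorial : is_factorial {poly C}.
Proof.
move=> f; elim/ltn_ind: (size f) {-2}f (erefl (size f)) => k IH {}f fk f0.
have [sf|sf] := leqP (size f) 1.
  have ef := size1_polyC sf; move: f0; rewrite ef polyC_eq0 => /facC [s si es].
  exists (map polyC s); last by rewrite big_map es rmorph_prod.
  by move=> _ /mapP [p /si ps ->]; apply: qprime_polyC.
have [c [g [efg pg]]] := primitive_part f0.
have c0 : c != 0 by apply: contraNneq f0 => c0; rewrite efg c0 mul0r.
have g0 : g != 0 by apply: contraNneq f0 => g0; rewrite efg g0 mulr0.
have sg : size g = size f by rewrite efg size_Cmul.
have [s si es] := facC c0.
have [t ti et] : exists2 t : seq {poly C}, (forall p, p \in t -> qprime p)
                                    & g = \prod_(p <- t) p.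
  case: (classic (irreducible_poly g)) => [gi|ng].
    exists [:: g]; last by rewrite big_seq1.
    by move=> p; rewrite inE => /eqP ->; apply: qprime_primitive_irreducible.
  have [q [q1 qg nqg]] : exists q : {poly C}, [/\ size q != 1%N, (q %| g)%R & ~~ (q %= g)%R].
    apply: NNPP => nq; apply: ng; split; first by rewrite sg.
    by move=> q q1 qg; apply: NNPP => /negP nqg; apply: nq; exists q.
  have q0 : q != 0 by apply: contraNneq g0 => q0; move: qg; rewrite q0 dvd0p.
  have [b [q' [eq pq']]] := primitive_part q0.
  have b0 : b != 0 by apply: contraNneq q0 => b0; rewrite eq b0 mul0r.
  have sq' : size q' = size q by rewrite eq size_Cmul.
  have q'g : (q' %| g)%R by apply: dvdp_trans qg; rewrite eq dvdp_mull.
  have [h eg] := primitive_dvd pq' q'g.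
  have q'0 : q' != 0 by rewrite -size_poly_eq0 sq' size_poly_eq0.
  have h0 : h != 0 by apply: contraNneq g0 => h0; rewrite eg h0 mulr0.
  have ltq : (size q' < k)%N.
    rewrite sq' -fk -sg ltn_neqAle dvdp_leq // andbT.
    by rewrite dvdp_size_eqp.
  have lth : (size h < k)%N.
    rewrite -fk -sg eg size_mul //; move: q1 q'0 h0; rewrite -sq' -!size_poly_eq0; lia.
  have [t1 t1i e1] := IH _ ltq q' erefl q'0.
  have [t2 t2i e2] := IH _ lth h erefl h0.
  exists (t1 ++ t2); last by rewrite big_cat /= -e1 -e2.
  by move=> p; rewrite mem_cat => /orP [/t1i|/t2i].
exists (map polyC s ++ t); last by rewrite big_cat /= big_map -rmorph_prod -es -et.
move=> p; rewrite mem_cat => /orP [/mapP [q /si qs ->]|/ti //].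
exact: qprime_polyC.
Qed.
End PolyFactorial.

Lemma qprime_bij (C D : idomainType) (phi : {rmorphism C -> D}) (p : C) :
  bijective phi -> (qprime (phi p) <-> qprime p).
Proof.
move=> bphi; have inj := bij_inj bphi; have [psi phiK psiK] := bphi.
have e0 x : (phi x == 0) = (x == 0) by rewrite -(inj_eq inj) rmorph0.
split=> [] [p0 pp]; split; rewrite ?e0 // -?e0 // => a b c e.
  have /pp : phi a * phi b = phi p * phi c by rewrite -!rmorphM e.
  by case=> [] [d ed]; [left|right]; exists (psi d); apply: inj; rewrite rmorphM psiK.
have /pp : psi a * psi b = p * psi c by apply: inj; rewrite !rmorphM !psiK.
by case=> [] [d ed]; [left|right]; exists (phi d); rewrite -rmorphM -ed psiK.
Qed.

Lemma factorial_bij (C D : idomainType) (phi : {rmorphism C -> D}) :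
  bijective phi -> is_factorial D -> is_factorial C.
Proof.
move=> bphi fD a a0; have inj := bij_inj bphi; have [psi phiK psiK] := bphi.
have /fD [s si es] : phi a != 0 by rewrite -(inj_eq inj) rmorph0 in a0 *.
exists (map psi s).
  by move=> _ /mapP [q /si qs ->]; rewrite -(qprime_bij _ bphi) psiK.
by apply: inj; rewrite es rmorph_prod big_map; apply: eq_bigr => q _; rewrite psiK.
Qed.

Lemma mpoly_rmorph_ext (k : nat) (R : nzRingType) (S : nzRingType)
    (al be : {rmorphism {mpoly R[k]} -> S}) :
  (forall c, al c%:MP = be c%:MP) -> (forall i, al 'X_i = be 'X_i) -> al =1 be.
Proof.
move=> eC eX p; rewrite [p]mpolyE !rmorph_sum; apply: eq_bigr => m _.
rewrite -mul_mpolyC !rmorphM eC mpolyXE_id !rmorph_prod; congr (_ * _).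
by apply: eq_bigr => i _; rewrite !rmorphXn eX.
Qed.

Local Notation widen := (widen_ord (leqnSn _)).

Lemma lift_ord_max n (i : 'I_n) : lift ord_max i = widen i.
Proof. by apply: val_inj; rewrite /= /bump leqNgt ltn_ord. Qed.

Section Muni.
Variables (n : nat) (R : idomainType).

Lemma mmapX_var (k : nat) (S : comNzRingType) (f : {rmorphism R -> S}) (h : 'I_k -> S) i :
  mmap f h 'X_i = h i.
Proof. by rewrite mmapX mmap1U. Qed.

Lemma mwiden_var (i : 'I_n) : mwiden ('X_i : {mpoly R[n]}) = 'X_(widen i).
Proof. by rewrite mwidenX mnmwiden1. Qed.

Lemma muni_ordmax : muni ('X_ord_max : {mpoly R[n.+1]}) = 'X.
Proof.
rewrite muniE msuppX big_seq1 mcoeffX eqxx scale1r mnm1E eqxx expr1.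
rewrite (_ : [multinom _ | i < n] = 0%MM) ?mpolyX0 ?scale1r //.
by apply/mnmP=> i; rewrite mnmE mnm1E mnm0E -val_eqE /= gtn_eqF.
Qed.

Lemma muni_widen (i : 'I_n) : muni ('X_(widen i) : {mpoly R[n.+1]}) = ('X_i)%:P.
Proof.
rewrite muniE msuppX big_seq1 mcoeffX eqxx scale1r mnm1E -val_eqE /= ltn_eqF //.
rewrite expr0 -mul_polyC mulr1; congr ('X_[_])%:P.
by apply/mnmP=> j; rewrite mnmE !mnm1E -!val_eqE.
Qed.

Lemma muni_mwiden (p : {mpoly R[n]}) : muni (mwiden p) = p%:P.
Proof.
apply: (@mpoly_rmorph_ext _ _ _ (@muni n R \o @mwiden n R) polyC) p => [c|i] /=.
  by rewrite mwidenC muniC.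
by rewrite mwiden_var muni_widen.
Qed.

Lemma mmap_muni (S : comNzRingType) (f : {rmorphism R -> S}) (h : 'I_n.+1 -> S) p :
  mmap f h p = (map_poly (mmap f (h \o widen)) (muni p)).[h ord_max].
Proof.
apply: (@mpoly_rmorph_ext _ _ _ (mmap f h)
  (horner_eval (h ord_max) \o map_poly (mmap f (h \o widen)) \o @muni n R)) p => [c|i] /=.
  by rewrite mmapC muniC map_polyC horner_evalE /= hornerC mmapC.
rewrite mmapX_var horner_evalE; case: (unliftP ord_max i) => [j ->|->]; last first.
  by rewrite muni_ordmax map_polyX hornerX.
by rewrite lift_ord_max muni_widen map_polyC hornerC /= mmapX_var.
Qed.

Lemma muni_bij : bijective (@muni n R).
Proof.
exists (fun q => (map_poly (@mwiden n R) q).['X_ord_max]) => [p|q].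
  rewrite -[RHS](_ : mmap (@mpolyC _ _) (fun i => 'X_i) p = p); last first.
    apply: (@mpoly_rmorph_ext _ _ _ (mmap (@mpolyC _ _) (fun i => 'X_i)) idfun) => [c|i] /=.
      by rewrite mmapC.
    by rewrite mmapX_var.
  by rewrite mmap_muni.
elim/poly_ind: q => [|q c IH]; first by rewrite rmorph0 horner0 rmorph0.
rewrite rmorphD rmorphM /= map_polyX map_polyC hornerMXaddC.
by rewrite rmorphD rmorphM /= IH muni_ordmax muni_mwiden.
Qed.

Lemma qprime_mwiden (p : {mpoly R[n]}) : qprime p -> qprime (mwiden p).
Proof.
by move=> pp; rewrite -(qprime_bij _ muni_bij) /= muni_mwiden; apply: qprime_polyC.
Qed.

End Muni.

Lemma mpoly_factorial (R : idomainType) (k : nat) :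
  is_factorial R -> is_factorial {mpoly R[k]}.
Proof.
move=> fR; elim: k => [|k IH]; last exact: factorial_bij (@muni_bij k R) (poly_factorial IH).
apply: (@factorial_bij _ _ (mmap (@idfun R) (fun _ : 'I_0 => 0))) fR.
exists (@mpolyC 0 R) => [p|c]; last by rewrite /= mmapC.
by apply: (@mpoly_rmorph_ext _ _ _ (@mpolyC 0 R \o mmap (@idfun R) (fun _ : 'I_0 => 0)) idfun)
  => [c|[]//] /=; rewrite mmapC.
Qed.

(** * Laurent rings inside the ambient field *)

Section IotaR.
Variables (R : idomainType) (F : fieldType) (iota : {rmorphism {fraction R} -> F}).
HB.instance Definition _ :=
  GRing.RMorphism.copy (iotaR iota) (iota \o @FracField.tofrac R).

End IotaR.

Section Laurent.
Variables (R : idomainType) (F : fieldType) (iota : {rmorphism {fraction R} -> F}).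
Local Notation iR := (iotaR iota).

Section LPeval.
Variables (k : nat) (y : 'I_k -> F).

Lemma mmap1D (m l : 'X_{1..k}) : mmap1 y (m + l)%MM = mmap1 y m * mmap1 y l.
Proof. by rewrite -!(mmapX y iR) mpolyXD rmorphM. Qed.

Hypothesis y0 : forall i, y i != 0.

Lemma mmap1_neq0 m : mmap1 y m != 0.
Proof. by rewrite /mmap1 prodf_seq_neq0; apply/allP => i _; rewrite expf_neq0. Qed.

Lemma lpevalK P m : lpeval iR y P m * mmap1 y m = mmap iR y P.
Proof. by rewrite /lpeval divfK // mmap1_neq0. Qed.

Lemma lpevalD P m Q l : lpeval iR y P m + lpeval iR y Q l =
  lpeval iR y (P * 'X_[l] + Q * 'X_[m]) (m + l).
Proof.
rewrite /lpeval mmap1D rmorphD !rmorphM /= !mmapX.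
by rewrite addf_div ?mmap1_neq0.
Qed.

Lemma lpevalM P m Q l : lpeval iR y P m * lpeval iR y Q l =
  lpeval iR y (P * Q) (m + l).
Proof. by rewrite /lpeval mmap1D rmorphM /= mulf_div. Qed.

Lemma lpevalC r : lpeval iR y r%:MP 0%MM = iR r.
Proof. by rewrite /lpeval mmapC mmap11 divr1. Qed.

Lemma lpevalX i : lpeval iR y 'X_i 0%MM = y i.
Proof. by rewrite /lpeval mmapX mmap1U mmap11 divr1. Qed.

Lemma lpevalV i : lpeval iR y 1 U_(i)%MM = (y i)^-1.
Proof. by rewrite /lpeval rmorph1 mmap1U div1r. Qed.
End LPeval.

Lemma lpeval_eq k (y z : 'I_k -> F) P m : y =1 z -> lpeval iR y P m = lpeval iR z P m.
Proof.
move=> e; rewrite /lpeval (mmap1_eq _ e); congr (_ / _).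
by apply: eq_bigr => a _; rewrite (mmap1_eq _ e).
Qed.

Variable (L : zmodType).

(* [corr y z T a b]: the substitution [y g := z g], for [g] in [T], turns some
   Laurent expression of [a] into an expression of [b]. *)
Inductive corr (y z : L -> F) (T : L -> Prop) : F -> F -> Prop :=
| corrC r : corr y z T (iR r) (iR r)
| corrV g : T g -> corr y z T (y g) (z g)
| corrI g : T g -> corr y z T (y g)^-1 (z g)^-1
| corrD a a' b b' : corr y z T a a' -> corr y z T b b' -> corr y z T (a + b) (a' + b')
| corrM a a' b b' : corr y z T a a' -> corr y z T b b' -> corr y z T (a * b) (a' * b').

Definition nz (y : L -> F) (T : L -> Prop) := forall g, T g -> y g != 0.

Section Corr.
Variables (y z : L -> F).
Implicit Type T : L -> Prop.

Lemma corr0 T : corr y z T 0 0.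
Proof. by rewrite -(rmorph0 iR); constructor. Qed.

Lemma corr1 T : corr y z T 1 1.
Proof. by rewrite -(rmorph1 iR); constructor. Qed.

Lemma corrN T a b : corr y z T a b -> corr y z T (- a) (- b).
Proof.
by rewrite -mulN1r -[- b]mulN1r -(rmorphN1 iR) => ab; apply: corrM => //; constructor.
Qed.

Lemma corrX T a b n : corr y z T a b -> corr y z T (a ^+ n) (b ^+ n).
Proof.
move=> ab; elim: n => [|n IH]; first exact: corr1.
by rewrite !exprS; apply: corrM.
Qed.

Lemma corr_prod T I (r : seq I) (A B : I -> F) :
  (forall i, corr y z T (A i) (B i)) ->
  corr y z T (\prod_(i <- r) A i) (\prod_(i <- r) B i).
Proof.
move=> h; elim: r => [|i r IH]; first by rewrite !big_nil; apply: corr1.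
by rewrite !big_cons; apply: corrM.
Qed.

Lemma corr_mmap1 T k (A B : 'I_k -> F) m :
  (forall i, corr y z T (A i) (B i)) -> corr y z T (mmap1 A m) (mmap1 B m).
Proof. by move=> h; apply: corr_prod => i; apply: corrX. Qed.

Lemma corr_mmap T k (A B : 'I_k -> F) (P : {mpoly R[k]}) :
  (forall i, corr y z T (A i) (B i)) -> corr y z T (mmap iR A P) (mmap iR B P).
Proof.
move=> h; rewrite /mmap; elim: (msupp P) => [|m r IH].
  by rewrite !big_nil; apply: corr0.
rewrite !big_cons; apply: corrD => //; apply: corrM; first exact: corrC.
exact: corr_mmap1.
Qed.

Lemma corr_lpeval T k (hs : 'I_k -> L) P m : (forall i, T (hs i)) ->
  corr y z T (lpeval iR (y \o hs) P m) (lpeval iR (z \o hs) P m).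
Proof.
move=> Ths; apply: corrM; first by apply: corr_mmap => i; apply: corrV.
rewrite -!prodfV; apply: corr_prod => i; rewrite -!exprVn.
by apply: corrX; apply: corrI.
Qed.

Lemma corr_sub T T' a b : (forall g, T g -> T' g) -> corr y z T a b -> corr y z T' a b.
Proof.
move=> TT'; elim=> [r|g /TT'|g /TT'|a1 a2 b1 b2 _ h1 _ h2|a1 a2 b1 b2 _ h1 _ h2];
by [apply: corrC|apply: corrV|apply: corrI|apply: corrD|apply: corrM].
Qed.

(** The conclusion ranges over every list [hs] covering [s], so that two correspondences can be
    rewritten over one common list and then added or multiplied. *)
Lemma corr_rep T a b : nz y T -> nz z T -> corr y z T a b ->
  exists2 s : seq L, (forall g, g \in s -> T g) &
    forall k (hs : 'I_k -> L), (forall i, T (hs i)) ->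
      (forall g, g \in s -> exists i, hs i = g) ->
      exists P m, a = lpeval iR (y \o hs) P m /\ b = lpeval iR (z \o hs) P m.
Proof.
move=> y0 z0; elim=> {a b} [r|g Tg|g Tg|a a' b b' _ [s sT hs] _ [t tT ht]
  |a a' b b' _ [s sT hs] _ [t tT ht]].
- by exists [::] => // k hs _ _; exists r%:MP, 0%MM; rewrite !lpevalC.
- exists [:: g] => [h|k hs _ /(_ g)]; first by rewrite inE => /eqP ->.
  by case=> [|i <-]; [rewrite inE|exists 'X_i, 0%MM; rewrite !lpevalX].
- exists [:: g] => [h|k hs _ /(_ g)]; first by rewrite inE => /eqP ->.
  by case=> [|i <-]; [rewrite inE|exists 1, U_(i)%MM; rewrite !lpevalV].
all: exists (s ++ t) => [g|k u Tu cov]; first by rewrite mem_cat => /orP [/sT|/tT].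
all: have [|P [m [-> ->]]] := hs k u Tu.
1,3: by move=> g gs; apply: cov; rewrite mem_cat gs.
all: have [|Q [l [-> ->]]] := ht k u Tu.
1,3: by move=> g gs; apply: cov; rewrite mem_cat gs orbT.
all: eexists; eexists.
  by split; rewrite lpevalD // => i /=; [apply: y0|apply: z0].
by split; rewrite lpevalM.
Qed.

Lemma seq_cover (s : seq L) : exists k (hs : 'I_k -> L),
  [/\ injective hs, forall i, hs i \in s & forall g, g \in s -> exists i, hs i = g].
Proof.
exists (size (undup s)), (tnth (in_tuple (undup s))); split.
- by apply/tuple_uniqP; rewrite undup_uniq.
- by move=> i; rewrite -mem_undup mem_tnth.
by move=> g; rewrite -mem_undup => /(@tnthP _ _ (in_tuple _)) [i ->]; exists i.
Qed.

Lemma corr_cover T a b : nz y T -> nz z T -> corr y z T a b ->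
  exists k (hs : 'I_k -> L), [/\ injective hs, forall i, T (hs i) &
    exists P m, a = lpeval iR (y \o hs) P m /\ b = lpeval iR (z \o hs) P m].
Proof.
move=> y0 z0 /(corr_rep y0 z0) [s sT hs]; have [k [u [iu us cu]]] := seq_cover s.
by exists k, u; split=> // [i|]; [apply: sT|apply: hs => // i; apply: sT].
Qed.

Lemma corr_left T a b : nz y T -> nz z T -> corr y z T a b -> laurent_ring iota y T a.
Proof.
move=> y0 z0 /(corr_cover y0 z0) [k [hs [_ Ths [P [m [-> _]]]]]].
by exists k, hs, P, m.
Qed.

Lemma corr_right T a b : nz y T -> nz z T -> corr y z T a b -> laurent_ring iota z T b.
Proof.
move=> y0 z0 /(corr_cover y0 z0) [k [hs [_ Ths [P [m [_ ->]]]]]].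
by exists k, hs, P, m.
Qed.

Lemma corr_total T a : laurent_ring iota y T a -> exists b, corr y z T a b.
Proof.
by case=> k [hs [P [m [Ths ->]]]]; eexists; apply: corr_lpeval.
Qed.

Lemma corr_agree T a b : (forall g, T g -> y g = z g) -> corr y z T a b -> a = b.
Proof.
by move=> h; elim=> [|//|g /h-> |? ? ? ? _ -> _ ->|? ? ? ? _ -> _ ->].
Qed.

End Corr.

Lemma corr_sym y z T a b : corr y z T a b -> corr z y T b a.
Proof. by elim=> *; constructor. Qed.

Section LaurentRing.
Variables (y : L -> F) (T : L -> Prop).
Hypothesis y0 : nz y T.
Local Notation LR := (laurent_ring iota y T).

Lemma laurent_corr a : LR a <-> corr y y T a a.
Proof.
split=> [/(@corr_total y y) [b ab]|]; last exact: corr_left.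
by rewrite {2}(corr_agree _ ab).
Qed.

Lemma laurent1 : LR 1.
Proof. by rewrite laurent_corr; apply: corr1. Qed.

Lemma laurentC r : LR (iR r).
Proof. by rewrite laurent_corr; constructor. Qed.

Lemma laurentV g : T g -> LR (y g).
Proof. by rewrite laurent_corr; constructor. Qed.

Lemma laurentI g : T g -> LR (y g)^-1.
Proof. by rewrite laurent_corr; constructor. Qed.

Lemma laurentD a b : LR a -> LR b -> LR (a + b).
Proof. by rewrite !laurent_corr; constructor. Qed.

Lemma laurentM a b : LR a -> LR b -> LR (a * b).
Proof. by rewrite !laurent_corr; constructor. Qed.

Lemma laurentX a n : LR a -> LR (a ^+ n).
Proof. by rewrite !laurent_corr; apply: corrX. Qed.

Lemma laurent_mmap1 k (A : 'I_k -> F) m : (forall i, LR (A i)) -> LR (mmap1 A m).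
Proof.
by rewrite laurent_corr => h; apply: corr_mmap1 => i; rewrite -laurent_corr.
Qed.

Lemma laurent_mmap k (A : 'I_k -> F) P : (forall i, LR (A i)) -> LR (mmap iR A P).
Proof.
by rewrite laurent_corr => h; apply: corr_mmap => i; rewrite -laurent_corr.
Qed.

Lemma laurent_ind (Q : F -> Prop) :
  (forall r, Q (iR r)) -> (forall g, T g -> Q (y g)) -> (forall g, T g -> Q (y g)^-1) ->
  (forall a b, LR a -> LR b -> Q a -> Q b -> Q (a + b)) ->
  (forall a b, LR a -> LR b -> Q a -> Q b -> Q (a * b)) -> forall a, LR a -> Q a.
Proof.
move=> hC hV hI hD hM a /(@corr_total y y) [b]; elim=> // {a b}.
all: move=> a a' b b' ha Qa hb Qb; (apply: hD || apply: hM) => //.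
all: exact: corr_left ha || exact: corr_left hb.
Qed.
End LaurentRing.

Lemma laurent_sub y (T T' : L -> Prop) a : (forall g, T g -> T' g) ->
  laurent_ring iota y T a -> laurent_ring iota y T' a.
Proof.
by move=> TT' [k [hs [P [m [Ths ->]]]]]; exists k, hs, P, m; split=> // i; apply: TT'.
Qed.

Lemma laurent_eq y z (T : L -> Prop) a : (forall g, T g -> y g = z g) ->
  laurent_ring iota y T a -> laurent_ring iota z T a.
Proof.
move=> yz [k [hs [P [m [Ths ->]]]]]; exists k, hs, P, m; split=> //.
by apply: lpeval_eq => i /=; apply: yz.
Qed.

Lemma laurent_finite y (T : L -> Prop) a : laurent_ring iota y T a ->
  exists2 s : seq L, (forall g, g \in s -> T g) & laurent_ring iota y (fun g => g \in s) a.
Proof.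
case=> k [hs [P [m [Ths ->]]]]; exists (codom hs) => [g /codomP [i ->] //|].
by exists k, hs, P, m; split=> // i; apply: codom_f.
Qed.

(** Relative to [T], because the values of a solution are tied by the equation and can be
    independent only on a subset such as the boundary of a domain. *)
Definition alg_independent_on (y : L -> F) (T : L -> Prop) : Prop :=
  forall (k : nat) (hs : 'I_k -> L), injective hs -> (forall i, T (hs i)) ->
    forall p : {mpoly R[k]}, mmap iR (y \o hs) p = 0 -> p = 0.

Lemma alg_independent_on_all x T : alg_independent iota x -> alg_independent_on x T.
Proof.
move=> ai k hs ihs _ p p0.
suff h : map_mpoly (@FracField.tofrac R) p = 0.
  apply/mpolyP => m; apply/eqP; rewrite mcoeff0 -tofrac_eq0.
  by rewrite -mcoeff_map_mpoly h mcoeff0.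
apply: (ai k hs ihs); rewrite -p0; move: {p0} p.
apply: (@mpoly_rmorph_ext _ _ _
  (mmap iota (fun i => x (hs i)) \o map_mpoly (@FracField.tofrac R)) (mmap iR (x \o hs)))
  => [c|i] /=.
  by rewrite /map_mpoly !mmapC.
by rewrite map_mpolyX !mmapX !mmap1U.
Qed.

Lemma alg_independent_on_sub y (T T' : L -> Prop) : (forall g, T g -> T' g) ->
  alg_independent_on y T' -> alg_independent_on y T.
Proof. by move=> TT' ai k hs ihs Ths; apply: ai => // i; apply: TT'. Qed.

Lemma alg_independent_on_eq y z (T : L -> Prop) : (forall g, T g -> y g = z g) ->
  alg_independent_on y T -> alg_independent_on z T.
Proof.
move=> yz ai k hs ihs Ths p p0; apply: (ai k hs ihs Ths); rewrite -p0.
apply: eq_bigr => m _; congr (_ * _); apply: mmap1_eq => i /=; exact: yz.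
Qed.

Lemma alg_independent_nz y T : alg_independent_on y T -> nz y T.
Proof.
move=> ai g Tg; apply/eqP => yg0.
have /ai : injective (fun i : 'I_1 => g) by move=> i j _; rewrite !ord1.
move=> /(_ (fun _ => Tg) 'X_ord0); rewrite mmapX mmap1U /= => /(_ yg0).
by move/mpolyP/(_ U_(ord0)%MM); rewrite mcoeffX eqxx mcoeff0 => /eqP; rewrite oner_eq0.
Qed.

Section Independent.
Variables (y z : L -> F) (T : L -> Prop).
Hypothesis ai : alg_independent_on y T.
Hypothesis z0 : nz z T.
Let y0 := alg_independent_nz ai.

(** An expression of 0 over [y] has zero numerator as a polynomial, so its counterpart over [z]
    vanishes. Independence is asked of [y] alone, hence [z] may be a translate satisfying algebraic
    relations. *)
Lemma corr_zero b : corr y z T 0 b -> b = 0.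
Proof.
case/(corr_cover y0 z0) => k [hs [ihs Ths [P [m [e ->]]]]].
have yh0 i : (y \o hs) i != 0 by apply: y0.
have : mmap iR (y \o hs) P = 0 by rewrite -(lpevalK yh0 P m) -e mul0r.
by move/(ai ihs Ths) => ->; rewrite /lpeval rmorph0 mul0r.
Qed.

Lemma corr_fun a b b' : corr y z T a b -> corr y z T a b' -> b = b'.
Proof.
move=> ab ab'; apply/eqP; rewrite -subr_eq0; apply/eqP; apply: corr_zero.
by rewrite -(subrr a); apply: corrD => //; apply: corrN.
Qed.
End Independent.

Section Restriction.
Variables (y : L -> F) (T T' : L -> Prop).
Hypothesis ai : alg_independent_on y T'.
Hypothesis TT' : forall g, T g -> T' g.
Let y0' := alg_independent_nz ai.
Let y0 : nz y T := fun g Tg => y0' (TT' Tg).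

Let z g := if excluded_middle_informative (T g) then y g else 1.

(* Setting the variables outside [T] to [1] retracts the larger Laurent ring
   onto the smaller one. *)
Lemma laurent_retraction a : laurent_ring iota y T' a ->
  exists b, corr y z T' a b /\ laurent_ring iota y T b.
Proof.
move=> /(@corr_total y z) [b ab]; exists b; split=> //.
elim: {a b} ab => [r|g _|g _|a a' b b' _ h1 _ h2|a a' b b' _ h1 _ h2].
- exact: laurentC.
- rewrite /z; case: excluded_middle_informative => Tg; [exact: laurentV|exact: laurent1].
- rewrite /z; case: excluded_middle_informative => Tg; first exact: laurentI.
  by rewrite invr1; apply: laurent1.
- exact: laurentD.
exact: laurentM.
Qed.

(** Apply the retraction to [a * b = c]: it fixes [b] and [c], so the image of [a] is the same
    quotient, and this image lies in the smaller ring. *)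
Lemma laurent_div a b c : laurent_ring iota y T b -> laurent_ring iota y T c ->
  b != 0 -> laurent_ring iota y T' a -> a * b = c -> laurent_ring iota y T a.
Proof.
move=> Tb Tc b0 Ta abc; have [a' [aa' Ta']] := laurent_retraction Ta.
have z0 : nz z T'.
  move=> g /y0' yg; rewrite /z.
  by case: excluded_middle_informative => Tg //; exact: oner_neq0.
have fix_ u : laurent_ring iota y T u -> corr y z T' u u.
  move=> /(@corr_total y z) [u' uu']; have e : u = u'.
    apply: corr_agree uu' => g Tg; rewrite /z; by case: excluded_middle_informative.
  by rewrite {2}e; apply: corr_sub uu'.
have : a' * b = c.
  apply: (corr_fun ai z0 (a := c)); last exact: fix_.
  by rewrite -abc; apply: corrM => //; apply: fix_.
by rewrite -abc => /(mulIf b0) <-.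
Qed.
End Restriction.
End Laurent.

(** * Units and primes of Laurent rings *)

Definition qprime_in (F : fieldType) (S : F -> Prop) (p : F) : Prop :=
  [/\ S p, p != 0 & forall a b c, S a -> S b -> S c -> a * b = p * c ->
     dvd_in S p a \/ dvd_in S p b].

Section LaurentPrime.
Variables (R : idomainType) (F : fieldType) (iota : {rmorphism {fraction R} -> F}).
Variables (L : zmodType) (y : L -> F).
Local Notation iR := (iotaR iota).
Local Notation LR T := (laurent_ring iota y T).

Section Units.
Variable T : L -> Prop.
Hypothesis y0 : nz y T.

Lemma unit_in1 : unit_in (LR T) 1.
Proof. by split; [exact: laurent1|exists 1; split; [exact: laurent1|rewrite mulr1]]. Qed.

Lemma unit_inM a b : unit_in (LR T) a -> unit_in (LR T) b -> unit_in (LR T) (a * b).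
Proof.
move=> [Ta [a' [Ta' aa']]] [Tb [b' [Tb' bb']]]; split; first exact: laurentM.
by exists (a' * b'); split; [exact: laurentM|rewrite mulrACA aa' bb' mulr1].
Qed.

Lemma unit_in_neq0 a : unit_in (LR T) a -> a != 0.
Proof.
by case=> _ [b [_ ab]]; apply: contra_eq_neq ab => ->; rewrite mul0r eq_sym oner_neq0.
Qed.

Lemma unit_inV a : unit_in (LR T) a -> unit_in (LR T) a^-1.
Proof.
move=> ua; have a0 := unit_in_neq0 ua; case: ua => Ta [b [Tb ab]].
have -> : a^-1 = b by apply: (mulfI a0); rewrite ab divff.
by split=> //; exists a; rewrite mulrC.
Qed.

Lemma unit_inX a n : unit_in (LR T) a -> unit_in (LR T) (a ^+ n).
Proof.
move=> ua; elim: n => [|n IH]; first exact: unit_in1.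
by rewrite exprS; apply: unit_inM.
Qed.

Lemma unit_in_var g : T g -> unit_in (LR T) (y g).
Proof.
move=> Tg; split; first exact: laurentV.
by exists (y g)^-1; split; [exact: laurentI|rewrite divff // y0].
Qed.

Lemma unit_in_mmap1 k (hs : 'I_k -> L) m :
  (forall i, T (hs i)) -> unit_in (LR T) (mmap1 (y \o hs) m).
Proof.
move=> Th; rewrite /mmap1; elim/big_rec: _ => [|i a _ ua]; first exact: unit_in1.
by apply: unit_inM => //; apply: unit_inX; apply: unit_in_var.
Qed.

Lemma unit_in_dvdl a b : LR T a -> LR T b -> unit_in (LR T) (a * b) -> unit_in (LR T) a.
Proof.
move=> Ta Tb [_ [c [Tc abc]]]; split=> //; exists (b * c).
by split; [exact: laurentM|rewrite mulrA].
Qed.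

Lemma unit_in_dvd u a : unit_in (LR T) u -> LR T a -> dvd_in (LR T) u a.
Proof.
move=> uu Ta; have u0 := unit_in_neq0 uu; have [Tv _] := unit_inV uu.
by exists (u^-1 * a); split; [exact: laurentM|rewrite mulVKf].
Qed.

Lemma qprime_in_unit u : unit_in (LR T) u -> qprime_in (LR T) u.
Proof.
move=> uu; split; [by case: uu|exact: unit_in_neq0 uu|] => a b c Ta _ _ _; left.
exact: unit_in_dvd.
Qed.

Lemma qprime_in_mul_unit p u :
  qprime_in (LR T) p -> unit_in (LR T) u -> qprime_in (LR T) (p * u).
Proof.
move=> [Tp p0 pp] uu; have u0 := unit_in_neq0 uu; split.
- by apply: laurentM => //; case: uu.
- by rewrite mulf_neq0.
have lift a : dvd_in (LR T) p a -> dvd_in (LR T) (p * u) a.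
  case=> c [Tc ->]; have [d [Td ->]] := unit_in_dvd uu Tc.
  by exists d; rewrite mulrA.
move=> a b c Ta Tb Tc; rewrite -mulrA => e; have Tu : LR T u by case: uu.
have [|/lift|/lift] := pp _ _ _ Ta Tb _ e; [exact: laurentM|by left|by right].
Qed.

Lemma irreducible_in_prod (I : eqType) (t : seq I) (f : I -> F) p u :
  irreducible_in (LR T) p -> unit_in (LR T) u -> (forall q, LR T (f q)) ->
  p = u * \prod_(q <- t) f q ->
  unit_in (LR T) p \/ exists2 q, q \in t & exists2 w, unit_in (LR T) w & p = f q * w.
Proof.
move=> [Tp [p0 pirr]] uu Tf; elim: t u uu => [|q t IH] u uu.
  by rewrite big_nil mulr1 => ->; left.
rewrite big_cons => e.
have Tr : LR T (u * \prod_(j <- t) f j).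
  apply: laurentM => //; first by case: uu.
  by elim: {IH e} t => [|r t IH]; rewrite ?big_nil ?big_cons; [exact: laurent1|exact: laurentM].
have e' : p = f q * (u * \prod_(j <- t) f j) by rewrite e mulrCA.
have [uq|ur] := pirr _ _ (Tf q) Tr e'.
  have [|| [r rt hr]] := IH (u * f q) (unit_inM uu uq); first by rewrite e mulrA.
    by left.
  by right; exists r; rewrite // in_cons rt orbT.
by right; exists q; [rewrite mem_head|exists (u * \prod_(j <- t) f j)].
Qed.
End Units.

Lemma laurent_cover T a : nz y T -> LR T a ->
  exists2 s : seq L, (forall g, g \in s -> T g) &
    forall k (hs : 'I_k -> L), (forall i, T (hs i)) ->
      (forall g, g \in s -> exists i, hs i = g) ->
      exists P m, a = lpeval iR (y \o hs) P m.
Proof.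
move=> y0; rewrite laurent_corr // => /(corr_rep y0 y0) [s sT h]; exists s => // k hs Th cov.
by have [P [m [e _]]] := h k hs Th cov; exists P, m.
Qed.

(** A divisibility in the Laurent ring may involve variables outside [hs]. They are adjoined one at
    a time as a new last variable, and [mwiden] keeps primes prime. *)
Lemma qprime_extend T k (hs : 'I_k -> L) (q : {mpoly R[k]}) (s : seq L) :
  injective hs -> (forall i, T (hs i)) -> (forall g, g \in s -> T g) -> qprime q ->
  exists k' (hs' : 'I_k' -> L), [/\ injective hs', forall i, T (hs' i),
    forall g, g \in s -> exists i, hs' i = g &
    exists2 q' : {mpoly R[k']}, qprime q' & mmap iR (y \o hs') q' = mmap iR (y \o hs) q].
Proof.
move=> ihs Ths; elim: s => [|g s IH] sT qq; first by exists k, hs; split=> //; exists q.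
have [|k' [u [iu Tu cu [q' qq' eq']]]] := IH _ qq.
  by move=> h hs'; apply: sT; rewrite in_cons hs' orbT.
case: (classic (exists i, u i = g)) => [gi|ng].
  by exists k', u; split=> // [h|]; [rewrite inE => /orP [/eqP ->|/cu]|exists q'].
pose w i := if unlift ord_max i is Some j then u j else g.
have wl j : w (widen j) = u j.
  by rewrite -lift_ord_max /w liftK.
have wm : w ord_max = g by rewrite /w unlift_none.
exists k'.+1, w; split.
- move=> i j; rewrite /w; case: unliftP => [a ->|->]; case: unliftP => [b ->|->] //.
  + by move=> /iu ->.
  + by move=> e; case: ng; exists a.
  + by move=> e; case: ng; exists b.
- by move=> i; rewrite /w; case: unliftP => [a _|_] //; apply: sT; rewrite mem_head.
- move=> h; rewrite inE => /orP [/eqP ->|/cu [i <-]]; first by exists ord_max.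
  by exists (widen i).
exists (mwiden q'); first exact: qprime_mwiden.
rewrite mmap_muni muni_mwiden map_polyC hornerC /= -eq'.
by apply: eq_bigr => m _; congr (_ * _); apply: mmap1_eq => i /=; rewrite wl.
Qed.

Lemma mmap_inj T k (hs : 'I_k -> L) : alg_independent_on iota y T ->
  injective hs -> (forall i, T (hs i)) -> injective (mmap iR (y \o hs)).
Proof.
move=> ai ihs Ths P Q e; apply/eqP; rewrite -subr_eq0; apply/eqP.
by apply: (ai _ _ ihs Ths); rewrite rmorphB /= e subrr.
Qed.

(** Clearing denominators gives a relation among polynomials in enough variables. The prime then
    divides [A], [B] or the monomial under [c]; in the last case its value is a unit and divides
    everything. *)
Lemma qprime_mmap T k (hs : 'I_k -> L) (q : {mpoly R[k]}) :
  alg_independent_on iota y T -> injective hs -> (forall i, T (hs i)) ->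
  qprime q -> qprime_in (LR T) (mmap iR (y \o hs) q).
Proof.
move=> ai ihs Ths qq; have y0 := alg_independent_nz ai.
have Tq : LR T (mmap iR (y \o hs) q).
  by apply: laurent_mmap => // i; apply: laurentV.
split=> //.
  by apply: contraNneq qq.1 => /(ai _ _ ihs Ths) ->.
move=> a b c Ta Tb Tc abc.
have [sa saT ha] := laurent_cover y0 Ta.
have [sb sbT hb] := laurent_cover y0 Tb.
have [sc scT hc] := laurent_cover y0 Tc.
have sT g : g \in sa ++ sb ++ sc -> T g.
  by rewrite !mem_cat => /or3P [/saT|/sbT|/scT].
have [k' [u [iu Tu cu [q' qq' eq']]]] := qprime_extend ihs Ths sT qq.
have yu0 i : (y \o u) i != 0 by apply: y0.
have [A [ma ea]] := ha k' u Tu (fun g gs => cu g ltac:(by rewrite !mem_cat gs)).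
have [B [mb eb]] := hb k' u Tu (fun g gs => cu g ltac:(by rewrite !mem_cat gs orbT)).
have [C [mc ec]] := hc k' u Tu (fun g gs => cu g ltac:(by rewrite !mem_cat gs !orbT)).
have unitq m d : 'X_[m] = q' * d -> unit_in (LR T) (mmap iR (y \o hs) q).
  move=> e; have Td : LR T (mmap iR (y \o u) d).
    by apply: laurent_mmap => // i; apply: laurentV.
  apply: (unit_in_dvdl y0 Tq Td); rewrite -eq' -rmorphM -e /= mmapX.
  exact: unit_in_mmap1.
have LRd d m : LR T (lpeval iR (y \o u) d m) by exists k', u, d, m.
have e : A * (B * 'X_[mc]) = q' * (C * 'X_[ma + mb]).
  apply: (mmap_inj ai iu Tu).
  rewrite !rmorphM /= !mmapX (mmap1D iota) eq' -(lpevalK iota yu0 A ma) -(lpevalK iota yu0 B mb).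
  rewrite -(lpevalK iota yu0 C mc) -ea -eb -ec.
  transitivity (a * b * (mmap1 (y \o u) ma * mmap1 (y \o u) mb * mmap1 (y \o u) mc)); first by ring.
  by rewrite abc; ring.
have dvd D m d : D = q' * d -> dvd_in (LR T) (mmap iR (y \o hs) q) (lpeval iR (y \o u) D m).
  by move=> ->; exists (lpeval iR (y \o u) d m); split=> //; rewrite -eq' /lpeval rmorphM /= mulrA.
case: (qq'.2 _ _ _ e) => [[d ed]|[d ed]]; first by left; rewrite ea; apply: dvd ed.
case: (qq'.2 _ _ _ ed) => [[d' ed']|[d' ed']]; first by right; rewrite eb; apply: dvd ed'.
by left; apply: unit_in_dvd => //; apply: unitq ed'.
Qed.

(** The numerator is a product of primes of a polynomial ring, and irreducibility leaves at most one
    up to units, monomials being units. Primes survive the adjunction of variables, so [T'] may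
    exceed [T]; for X, [T] is the finite set of arguments of Psi. *)
Lemma irreducible_qprime_in (T T' : L -> Prop) p : UFD R ->
  alg_independent_on iota y T' -> (forall g, T g -> T' g) ->
  irreducible_in (LR T) p -> qprime_in (LR T') p.
Proof.
move=> ufd ai TT' pirr; have y0' := alg_independent_nz ai.
have y0 : nz y T by move=> g /TT' /y0'.
have unit_sub u : unit_in (LR T) u -> unit_in (LR T') u.
  case=> Tu [w [Tw uw]]; split; first exact: laurent_sub Tu.
  by exists w; split=> //; apply: laurent_sub Tw.
have [Tp [p0 _]] := pirr.
have [s sT hsr] := laurent_cover y0 Tp.
have [k [hs [ihs hss cov]]] := seq_cover s.
have Ths i : T (hs i) by apply: sT.
have [P [m ep]] := hsr k hs Ths cov.
have P0 : P != 0 by apply: contraNneq p0 => P0; rewrite ep P0 /lpeval rmorph0 mul0r.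
have [t ti et] := mpoly_factorial (UFD_factorial ufd) P0.
have Tf q : LR T (mmap iR (y \o hs) q).
  by apply: laurent_mmap => // i; apply: laurentV.
have um := unit_inV (unit_in_mmap1 y0 m Ths).
case: (irreducible_in_prod y0 (t := t) pirr um Tf).
- by rewrite ep /lpeval et rmorph_prod mulrC.
- by move=> /unit_sub; apply: qprime_in_unit.
case=> q /ti qq [w /unit_sub uw ->]; apply: qprime_in_mul_unit => //.
by apply: qprime_mmap => // i; apply: TT'.
Qed.
End LaurentPrime.

(** * Light cones *)

Section LightCone.
Variables (L : zmodType) (n : nat) (v : 'I_n.+1 -> L).
Hypothesis v_indep : nonneg_independent v.
Local Notation "a <<= b" := (lcle v a b) (at level 70).
Local Notation vN := (v ord_max).

Lemma inS0 : inS v 0.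
Proof. by exists (fun _ => 0%N); rewrite big1. Qed.

Lemma inSD a b : inS v a -> inS v b -> inS v (a + b).
Proof.
move=> [p ->] [q ->]; exists (fun i => (p i + q i)%N).
by rewrite -big_split; apply: eq_bigr => i _; rewrite mulrnDr.
Qed.

Lemma inS_var i : inS v (v i).
Proof.
exists (fun j => (j == i) : nat); rewrite (bigD1 i) //= eqxx mulr1n.
by rewrite big1 ?addr0 // => j /negbTE ->; rewrite mulr0n.
Qed.

Lemma inS_anti a : inS v a -> inS v (- a) -> a = 0.
Proof.
move=> [p ep] [q eq]; have h : \sum_(i < n.+1) v i *+ (p i + q i) = 0.
  under eq_bigr do rewrite mulrnDr.
  by rewrite big_split /= -ep -eq subrr.
rewrite ep big1 // => i _; have := v_indep h i.
by case: (p i).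
Qed.

Lemma inS_pos a : inS v a -> a != 0 -> exists i, inS v (a - v i).
Proof.
move=> [p ep] a0.
case: (classic (exists i, (0 < p i)%N)) => [[i pi]|np]; last first.
  case/eqP: a0; rewrite ep big1 // => i _.
  case: (posnP (p i)) => [->|pi]; first by rewrite mulr0n.
  by case: np; exists i.
exists i, (fun j => (p j - (j == i))%N).
have e : v i *+ p i = v i *+ (p i - 1) + v i by rewrite -mulrSr subn1 prednK.
rewrite ep (bigD1 i) //= [RHS](bigD1 i) //= eqxx e addrAC addrK; congr (_ + _).
by apply: eq_bigr => j /negbTE ->; rewrite subn0.
Qed.

Lemma lcle_refl a : a <<= a.
Proof. by rewrite /lcle subrr; apply: inS0. Qed.

Lemma lcle_trans b a c : a <<= b -> b <<= c -> a <<= c.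
Proof. by move=> ab bc; have := inSD ab bc; rewrite addrA subrK. Qed.

Lemma lcle_anti a b : a <<= b -> b <<= a -> a = b.
Proof.
move=> ab ba; apply/eqP; rewrite -subr_eq0; apply/eqP; apply: inS_anti => //.
by rewrite opprB.
Qed.

Lemma lcle_addr t a b : (a + t <<= b + t) <-> (a <<= b).
Proof. by rewrite /lcle opprD addrACA subrr addr0. Qed.

Lemma lcle_var a i : a + v i <<= a.
Proof. by rewrite /lcle addrAC subrr add0r; apply: inS_var. Qed.

Lemma var_neq0 i : v i != 0.
Proof.
apply/eqP => vi0; have := @v_indep (fun j => (j == i) : nat) _ i; rewrite eqxx.
suff -> : \sum_(j < n.+1) v j *+ (j == i) = 0 by move=> /(_ erefl).
rewrite big1 // => j _; have [->|_] := eqVneq j i; first by rewrite vi0 mul0rn.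
by rewrite mulr0n.
Qed.

Lemma add_var_neq a i : a + v i <> a.
Proof. by move/eqP; rewrite addrC -subr_eq0 addrK; apply/negP; apply: var_neq0. Qed.

Hypothesis v_min : forall i, vN <<= v i.

(** Adding [vN - v j], which is in [S], would put [- v i] in [S]. This keeps the arguments of one
    equation out of the cones removed in [orbit_independent]. *)
Lemma var_sub_notin i j : ~ inS v (v j - (v i + vN)).
Proof.
move=> h; have := inSD h (v_min j); rewrite addrC addrA subrK.
rewrite opprD [- v i - _]addrC addNKr => h'.
have /eqP := inS_anti (inS_var i) h'; exact/negP/var_neq0.
Qed.

(** As the [v i] generate [L], every element is a difference of elements of [S]; if [d - u = p - q],
    the point [d - p = u - q] lies above both [d] and [u]. *)
Lemma lcle_directed (s : seq L) : generates v -> exists u, forall d, d \in s -> d <<= u.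
Proof.
move=> gen; have diff h : exists p q, [/\ inS v p, inS v q & h = p - q].
  have [a ->] := gen h.
  apply: (big_ind (fun h => exists p q, [/\ inS v p, inS v q & h = p - q])).
  - by exists 0, 0; split; rewrite ?subr0 //; apply: inS0.
  - move=> _ _ [p [q [Sp Sq ->]]] [p' [q' [Sp' Sq' ->]]].
    by exists (p + p'), (q + q'); split; rewrite ?opprD 1?addrACA //; apply: inSD.
  have mulS k i : inS v (v i *+ k).
    by elim: k => [|k IH]; rewrite ?mulr0n ?mulrS; [exact: inS0|apply: inSD => //; exact: inS_var].
  move=> i _; case: (a i) => k.
    by exists (v i *+ k), 0; rewrite subr0; split=> //; apply: inS0.
  by exists 0, (v i *+ k.+1); rewrite sub0r NegzE mulrNz; split=> //; apply: inS0.
elim: s => [|d s [u hu]]; first by exists 0.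
have [p [q [Sp Sq e]]] := diff (d - u).
exists (d - p) => c; rewrite inE => /orP [/eqP ->|/hu cu].
  by rewrite /lcle opprB addrC subrK.
apply: lcle_trans cu _; rewrite /lcle.
suff -> : u - (d - p) = q by [].
apply/eqP; rewrite subr_eq -[d](subrK u) e.
by rewrite (addrAC _ u) (addrAC p) subrr sub0r addrA subrr add0r.
Qed.

Lemma size_filter_predC1 (h : L) s : h \in s -> (size (filter (predC1 h) s) < size s)%N.
Proof.
move=> hs; rewrite size_filter -(count_predC (predC1 h) s) -addn1 leq_add2l -has_count.
by apply/hasP; exists h => //=; rewrite eqxx.
Qed.

(** The half of light-cone regularity that is carried along removals; finiteness of lower cones is
    taken from the surrounding regular domain. *)
Definition upper (H : L -> Prop) : Prop := forall h h', H h -> h <<= h' -> H h'.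

Lemma lcr_upper H : light_cone_regular v H -> upper H.
Proof. by move=> [_ lc] h h' /lc [_]; apply. Qed.

(** A finite list contains all points of [H] below [h], and passing to a strictly lower point
    deletes [h] from it. *)
Lemma lcr_ind (H : L -> Prop) (Q : L -> Prop) : light_cone_regular v H ->
  (forall h, H h -> (forall h', H h' -> h' <<= h -> h' <> h -> Q h') -> Q h) ->
  forall h, H h -> Q h.
Proof.
move=> [_ lc] IH h Hh; have [[s hs] _] := lc h Hh.
elim/ltn_ind: {s}(size s) {-2}s (erefl (size s)) h Hh hs => k IHk s sk h Hh hs.
apply: (IH h Hh) => h' Hh' h'h nh'.
have hin : h \in s by apply: hs => //; apply: lcle_refl.
have sz := size_filter_predC1 hin; rewrite sk in sz.
apply: (IHk _ sz _ erefl h' Hh') => g Hg gh'.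
rewrite mem_filter hs ?andbT //=; last exact: lcle_trans h'h.
by apply/eqP => eg; apply: nh'; apply: lcle_anti h'h _; rewrite -eg.
Qed.

(** [h + vN] is the lowest of the points [h + v i], so an upper set containing it contains the
    others. *)
Lemma boundaryE (H : L -> Prop) h : upper H ->
  init_boundary v H h <-> H h /\ ~ H (h + vN).
Proof.
move=> uH; split=> [[Hh [i hi]]|[Hh nh]]; last by split=> //; exists ord_max.
split=> // hN; apply: hi; apply: uH hN _.
by rewrite ![h + _]addrC lcle_addr.
Qed.

Lemma not_boundaryP (H : L -> Prop) h : H h -> ~ init_boundary v H h -> forall i, H (h + v i).
Proof. by move=> Hh nb i; apply: NNPP => ni; apply: nb; split=> //; exists i. Qed.

Lemma maximal_element (s : seq L) (A : L -> Prop) h : (forall g, A g -> g \in s) -> A h ->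
  exists2 h0, A h0 & forall g, A g -> h0 <<= g -> g = h0.
Proof.
elim/ltn_ind: {s}(size s) {-2}s (erefl (size s)) A h => k IH s sk A h As Ah.
case: (classic (exists g, [/\ A g, h <<= g & g <> h])) => [[g [Ag hg ngh]]|nm]; last first.
  by exists h => // g Ag hg; apply: NNPP => ne; apply: nm; exists g.
have sz := size_filter_predC1 (As h Ah); rewrite sk in sz.
pose B x := A x /\ g <<= x.
have [||h0 [Ah0 gh0] mh0] := IH _ sz (filter (predC1 h) s) erefl B g.
- move=> x [Ax gx]; rewrite mem_filter As // andbT /=; apply/eqP => xh.
  by apply: ngh; apply: lcle_anti hg; rewrite -xh.
- by split=> //; apply: lcle_refl.
by exists h0 => // x Ax h0x; apply: mh0 => //; split=> //; apply: lcle_trans h0x.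
Qed.

(** Induction on the finite complement of [G], putting back a maximal missing point [h0]. Maximality
    makes the enlarged set upper, and [h0] is minimal in it because [G] is upper and misses [h0]. *)
Lemma remove_ind (Pr : (L -> Prop) -> Prop) (H : L -> Prop) :
  upper H -> Pr H ->
  (forall G h0, upper G -> (forall g, G g -> H g) -> G h0 -> (forall i, ~ G (h0 + v i)) ->
     Pr G -> Pr (fun g => G g /\ g <> h0)) ->
  forall G (s : seq L), upper G -> (forall g, G g -> H g) ->
    (forall g, H g -> ~ G g -> g \in s) -> Pr G.
Proof.
move=> uH PH step G s; elim/ltn_ind: {s}(size s) {-2}s (erefl (size s)) G => k IH s sk G uG GH Gs.
have ext (G' : L -> Prop) : (forall g, G' g <-> G g) -> Pr G' -> Pr G.
  move=> e; suff -> : G' = G by [].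
  by apply: functional_extensionality => g; apply: propositional_extensionality.
case: (classic (exists g, H g /\ ~ G g)) => [[g hg]|nG]; last first.
  apply: ext PH => g; split=> [Hg|/GH //]; apply: NNPP => nGg; apply: nG; by exists g.
have [h0 [Hh0 nGh0] mh0] :=
  @maximal_element s (fun g => H g /\ ~ G g) g (fun g hg => Gs g hg.1 hg.2) hg.
have h0s := Gs _ Hh0 nGh0.
pose G1 g := G g \/ g = h0.
have uG1 : upper G1.
  move=> a b [Ga|->] ab; first by left; apply: uG ab.
  case: (classic (G b)) => Gb; [by left|right].
  by apply: mh0 => //; split=> //; apply: uH ab.
have G1H a : G1 a -> H a by move=> [/GH|->].
have PG1 : Pr G1.
  have sz := size_filter_predC1 h0s; rewrite sk in sz.
  apply: (IH _ sz (filter (predC1 h0) s) erefl) => // a Ha nG1.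
  rewrite mem_filter Gs // ?andbT /=; last by move=> Ga; apply: nG1; left.
  by apply/eqP => e; apply: nG1; right.
apply: ext (step G1 h0 uG1 G1H _ _ PG1) => [a||i].
- split=> [[[//|-> /(_ erefl) []]]|Ga]; split; first by left.
  by move=> e; apply: nGh0; rewrite -e.
- by right.
case=> [Gi|]; last exact: add_var_neq.
by apply: nGh0; apply: uG Gi _; apply: lcle_var.
Qed.

Section Removal.
Variables (H : L -> Prop) (h0 : L).
Hypotheses (uH : upper H) (Hh0 : H h0) (minh0 : forall i, ~ H (h0 + v i)).
Let H' g := H g /\ g <> h0.
Let w0 := h0 - vN.

Lemma removal_upper : upper H'.
Proof.
move=> a b [Ha nah0] ab; split; first exact: uH ab.
move=> e; rewrite {}e in ab; have [|i hi] := inS_pos ab; first by rewrite subr_eq0; apply/eqP.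
apply: (minh0 (i := i)); apply: uH Ha _.
by rewrite /lcle opprD addrA.
Qed.

Lemma removal_top : w0 + vN = h0.
Proof. by rewrite /w0 subrK. Qed.

Lemma removal_new : H w0.
Proof. by apply: uH Hh0 _; rewrite -{1}removal_top; apply: lcle_var. Qed.

Lemma removal_new_neq i : w0 <> w0 + v i.
Proof. by move=> /esym; apply: add_var_neq. Qed.

Lemma removal_boundary g : init_boundary v H' g <-> (init_boundary v H g /\ g <> h0) \/ g = w0.
Proof.
rewrite !boundaryE //; last exact: removal_upper.
split=> [[[Hg ngh0] nH']|[[[Hg nH] ngh0]|->]].
- case: (classic (H (g + vN))) => hN; last by left.
  right; apply: NNPP => ne; apply: nH'; split=> // e.
  by apply: ne; rewrite /w0 -e addrK.
- by split=> // - [].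
split; last by rewrite removal_top => - [].
split; first exact: removal_new.
by move=> e; have := removal_new_neq (i := ord_max); rewrite removal_top.
Qed.

(** [w0 + v i + vN] is [h0 + v i], which is missing from [H]. So all arguments of Phi at [w0] are
    initial variables before the removal. *)
Lemma removal_old i : init_boundary v H (w0 + v i).
Proof.
apply/boundaryE => //; split.
  apply: uH Hh0 _; rewrite -{1}removal_top ![w0 + _]addrC lcle_addr; exact: v_min.
by rewrite addrAC removal_top; apply: minh0.
Qed.
End Removal.
End LightCone.

(** * Solutions and their algebraic independence *)

Lemma fun_choice (I T : Type) (Q : I -> T -> Prop) :
  (forall i, exists x, Q i x) -> exists f, forall i, Q i (f i).
Proof.
move=> h; exists (fun i => proj1_sig (constructive_indefinite_description _ (h i))) => i.
exact: proj2_sig (constructive_indefinite_description _ (h i)).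
Qed.

Section Existence.
Variables (R : idomainType) (F : fieldType) (iota : {rmorphism {fraction R} -> F}).
Variables (L : zmodType) (n : nat) (v : 'I_n.+1 -> L).
Variables (P : {mpoly R[n.+1]}) (mP : 'X_{1..n.+1}).
Hypothesis v_indep : nonneg_independent v.

(** The three properties quantify over all solutions; to exploit them as hypotheses on a domain, a
    solution must be at hand. *)
Lemma solution_exists (y : L -> F) (H : L -> Prop) :
  light_cone_regular v H -> exists f, is_solution iota y v P mP H f.
Proof.
move=> lcH; pose phi (u : 'I_n.+1 -> F) := lpeval (iotaR iota) u P mP.
(* [m] bounds the depth of the recursion; the value 0 given when it runs out has no effect for large
   [m], as [stable] shows. *)
pose fix approx (m : nat) (h : L) {struct m} : F := if m is m'.+1 then
  if excluded_middle_informative (init_boundary v H h) then y h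
  else phi (fun i => approx m' (h + v i)) else 0.
have stable : forall h, H h -> exists c, exists N, forall m, (N <= m)%N -> approx m h = c.
  apply: (lcr_ind v_indep lcH) => h Hh IH.
  case: (classic (init_boundary v H h)) => bh.
    by exists (y h), 1%N => - [|m] //= _; case: excluded_middle_informative.
  have Hi := not_boundaryP Hh bh.
  have [c hc] : exists c : 'I_n.+1 -> F, forall i, exists N, forall m, (N <= m)%N ->
      approx m (h + v i) = c i.
    apply: (fun_choice
      (Q := fun i c => exists N, forall m, (N <= m)%N -> approx m (h + v i) = c)) => i.
    apply: IH (Hi i) _ _; first exact: lcle_var.
    exact: add_var_neq.
  have [N hN] := fun_choice hc.
  exists (phi c), (\max_i N i).+1 => - [|m] //= lem; case: excluded_middle_informative => bh' //.
  apply: lpeval_eq => i; apply: hN; exact: leq_trans (leq_bigmax i) lem.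
have [f hf] : exists f : L -> F, forall h, H h ->
    exists N, forall m, (N <= m)%N -> approx m h = f h.
  apply: (fun_choice
    (Q := fun h c => H h -> exists N, forall m, (N <= m)%N -> approx m h = c)) => h.
  case: (classic (H h)) => [/stable [c hc]|nH]; first by exists c.
  by exists 0.
exists f; split=> h.
  move=> bh; have Hh := bh.1; have [N hN] := hf h Hh.
  by rewrite -(hN N.+1) //=; case: excluded_middle_informative.
move=> Hh bh; have Hi := not_boundaryP Hh bh; have [N hN] := hf h Hh.
have [M hM] := fun_choice (fun i => hf _ (Hi i)).
rewrite -(hN (maxn N (\max_i M i)).+1); last by rewrite leqW // leq_maxl.
rewrite /=; case: excluded_middle_informative => bh' //.
by apply: lpeval_eq => i; apply: hM; rewrite leq_max; apply/orP; right; apply: leq_bigmax.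
Qed.
End Existence.

(* With [X] transcendental, [W = phi(X) / (M X^m)] is algebraic over the
   coefficients only if it does not involve [X].  The relation [pi(W) = 0] becomes
   [sum_i pi_i phi^i (M X^m)^(d-i) = 0]; compare the lowest powers of [X] if [phi]
   has fewer than [m] factors [X], and the leading terms otherwise. *)
Lemma poly_fun_transcendental (D : idomainType) (F : fieldType)
    (ev : {rmorphism D -> F}) (X W : F) (pi phi : {poly D}) (M : D) (m : nat) :
  (forall q : {poly D}, (map_poly ev q).[X] = 0 -> q = 0) ->
  W * (ev M * X ^+ m) = (map_poly ev phi).[X] -> M != 0 ->
  (map_poly ev pi).[W] = 0 -> pi != 0 -> exists c, phi = c%:P * 'X^m.
Proof.
move=> inj eW M0 piW pi0.
pose d := (size pi).-1; have sd : size pi = d.+1 by rewrite prednK // size_poly_gt0.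
pose T i := pi`_i *: phi ^+ i * (M *: 'X^m) ^+ (d - i).
have sum0 : \sum_(i < d.+1) T i = 0.
  apply: inj; rewrite rmorph_sum horner_sum.
  transitivity ((ev M * X ^+ m) ^+ d * (map_poly ev pi).[W]); last by rewrite piW mulr0.
  rewrite (horner_coef_wide _ (n := d.+1)); last by rewrite -sd size_poly.
  rewrite mulr_sumr; apply: eq_bigr => i _.
  have id : (i <= d)%N by rewrite -ltnS.
  rewrite /T rmorphM rmorphXn /= !map_polyZ /= rmorphXn /= map_polyXn.
  rewrite hornerM hornerZ !horner_exp hornerZ hornerXn -eW coef_map /=.
  set Z := ev M * _; have -> : Z ^+ d = Z ^+ (d - i) * Z ^+ i by rewrite -exprD subnK.
  by rewrite exprMn; ring.
have [->|phi0] := eqVneq phi 0; first by exists 0; rewrite mul0r.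
have [s [q]] := multiplicity_XsubC phi 0; rewrite phi0 polyC0 subr0 /= => qr ephi.
have q0 : q.[0] != 0 by [].
have X0 k : 'X^k != 0 :> {poly D} by rewrite monic_neq0 // monicXn.
have pid : pi`_d != 0 by rewrite -lead_coefE lead_coef_eq0.
case: (ltnP s m) => sm.
  have e : \sum_(i < d.+1) T i = 'X^(s * d) *
      \sum_(i < d.+1) pi`_i *: q ^+ i * (M ^+ (d - i) *: 'X^((m - s) * (d - i))).
    rewrite mulr_sumr; apply: eq_bigr => i _; have id : (i <= d)%N by rewrite -ltnS.
    rewrite /T ephi exprMn exprZn -!exprM -!mul_polyC.
    have ex : 'X^(s * i) * 'X^(m * (d - i)) = 'X^(s * d) * 'X^((m - s) * (d - i)) :> {poly D}.
      by rewrite -!exprD; congr ('X^_); nia.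
    move: ex; move: ('X^(s * i)) ('X^(m * (d - i))) ('X^(s * d)) ('X^((m - s) * (d - i)))
      (q ^+ i) => x1 x2 x3 x4 x5 ex.
    transitivity ((pi`_i)%:P * (M ^+ (d - i))%:P * x5 * (x1 * x2)); first by ring.
    by rewrite ex; ring.
  move: sum0; rewrite e => /eqP; rewrite mulf_eq0 (negbTE (X0 _)) /= => /eqP.
  (* At 0 only the term [i = d] survives, since the exponent [(m - s) * (d - i)] is positive for
     [i < d]. *)
  move/(congr1 (horner^~ 0)); rewrite horner0 horner_sum big_ord_recr /= big1 => [|i _].
    rewrite add0r subnn muln0 expr0 expr0 scale1r mulr1 hornerZ horner_exp => /eqP.
    by rewrite mulf_eq0 (negbTE pid) expf_eq0 (negbTE q0) andbF.
  have X00 : ('X^((m - s) * (d - i)) : {poly D}).[0] = 0.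
    by rewrite hornerXn expr0n muln_eq0 !subn_eq0 leqNgt sm leqNgt ltn_ord.
  by rewrite hornerM [X in _ * X]hornerZ X00 !mulr0.
(* Now [psi] is [phi] divided by the [m]-th power of the variable, and [pit] is [pi] at x / M with
   denominators cleared by [M ^+ d]. A composite with nonconstant [psi] has nonzero leading
   coefficient. *)
pose psi := q * 'X^(s - m).
pose pit := \poly_(i < d.+1) (pi`_i * M ^+ (d - i)).
have e : \sum_(i < d.+1) T i = 'X^(m * d) * (pit \Po psi).
  rewrite comp_polyE (big_ord_widen_cond _ xpredT (fun i => pit`_i *: psi ^+ i) (size_poly _ _)).
  rewrite [in RHS]big_mkcond /= mulr_sumr; apply: eq_bigr => i _.
  have id : (i <= d)%N by rewrite -ltnS.
  have -> : (if (i < size pit)%N then pit`_i *: psi ^+ i else 0) = pit`_i *: psi ^+ i.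
    by case: ltnP => // /(nth_default 0) ->; rewrite scale0r.
  rewrite coef_poly ltnS id /T /psi ephi !exprMn exprZn -!exprM -!mul_polyC polyCM.
  have ex : 'X^(s * i) * 'X^(m * (d - i)) = 'X^(m * d) * 'X^((s - m) * i) :> {poly D}.
    by rewrite -!exprD; congr ('X^_); nia.
  move: ex; move: ('X^(s * i)) ('X^(m * (d - i))) ('X^(m * d)) ('X^((s - m) * i))
    (q ^+ i) => x1 x2 x3 x4 x5 ex.
  transitivity ((pi`_i)%:P * (M ^+ (d - i))%:P * x5 * (x1 * x2)); first by ring.
  by rewrite ex; ring.
move: sum0; rewrite e => /eqP; rewrite mulf_eq0 (negbTE (X0 _)) /= => /eqP comp0.
have [spsi|spsi] := leqP (size psi) 1.
  exists psi`_0; rewrite -(size1_polyC spsi) /psi -mulrA -exprD subnK //.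
have : lead_coef (pit \Po psi) != 0.
  rewrite lead_coef_comp // mulf_neq0 ?expf_neq0 //; last first.
    by rewrite lead_coef_eq0 -size_poly_gt0 (ltn_trans _ spsi).
  rewrite lead_coef_eq0; apply: contraNneq pid => pit0.
  have := congr1 (fun r : {poly D} => r`_d) pit0.
  by rewrite coef_poly ltnSn subnn expr0 mulr1 coef0 => ->.
by rewrite comp0 lead_coef0 eqxx.
Qed.

Section IndependenceStep.
Variables (R : idomainType) (F : fieldType) (iota : {rmorphism {fraction R} -> F}).
Variables (L : zmodType) (n : nat) (v : 'I_n.+1 -> L).
Variables (P : {mpoly R[n.+1]}) (mP : 'X_{1..n.+1}).
Local Notation iR := (iotaR iota).
Hypothesis v_inj : injective v.
Hypothesis v_indep : nonneg_independent v.
Hypothesis v_min : forall i, lcle v (v ord_max) (v i).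

(* [muni] singles out the last variable, the one attached to [v_N]. *)
Lemma depends_on_ordmax : depends_on (PhiF P mP) ord_max ->
  forall c, muni P <> c%:P * 'X^(mP ord_max).
Proof.
move=> dep c e; apply: dep.
have eP : P = mwiden c * 'X_ord_max ^+ mP ord_max.
  apply: (bij_inj (@muni_bij n R)).
  by rewrite e rmorphM rmorphXn /= muni_mwiden muni_ordmax.
pose m' := mnmwiden [multinom mP (widen i) | i < n].
have emP : mP = (m' + U_(ord_max) *+ mP ord_max)%MM.
  apply/mnmP => i; rewrite mnmDE mulmnE mnm1E.
  case: (unliftP ord_max i) => [j ->|->].
    by rewrite lift_ord_max mnmwiden_widen mnmE -val_eqE /= gtn_eqF ?muln0 ?mul0n ?addn0.
  by rewrite mnmwiden_ordmax eqxx mul1n.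
exists (mwiden c), m'; split; last split.
- rewrite /PhiF /lpfrac {1}eP {2}emP mpolyXD -mpolyXn !tofracM.
  have X0 : ('X_ord_max ^+ mP ord_max : {mpoly R[n.+1]})%:F != 0.
    by rewrite tofrac_eq0 mpolyXn; apply/eqP => /mpolyP /(_ (U_(ord_max) *+ mP ord_max)%MM);
       rewrite mcoeffX eqxx mcoeff0 => /eqP; rewrite oner_eq0.
  by rewrite -mulf_div divff // mulr1.
- exact: mnmwiden_ordmax.
move=> mo; apply: contraTeq => mo0; rewrite mcoeff_msupp negbK.
rewrite (mwidenE (leqnn _)) raddf_sum /= big1 // => m _.
rewrite mcoeffZ mcoeffX; case: eqP => [e'|_]; last by rewrite mulr0.
by case/eqP: mo0; rewrite -e' mnmwiden_ordmax.
Qed.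

Variables (H : L -> Prop) (h0 : L) (f : L -> F).
Hypotheses (uH : upper v H) (Hh0 : H h0) (minh0 : forall i, ~ H (h0 + v i)).
Let w0 := h0 - v ord_max.
Hypothesis fw0 : f w0 = lpeval iR (fun i => f (w0 + v i)) P mP.
Hypothesis dep : depends_on (PhiF P mP) ord_max.

(** A relation among the new boundary values that involves W makes W algebraic over the old
    variables other than X. By [poly_fun_transcendental] Phi would then be free of [Y_N], against
    [dep]. *)
Lemma alg_independent_removal :
  alg_independent_on iota f (init_boundary v H) ->
  alg_independent_on iota f (init_boundary v (fun g => H g /\ g <> h0)).
Proof.
move=> ai k hs ihs Ths p p0; have f0 := alg_independent_nz ai.
have bdh i : init_boundary v H (hs i) /\ hs i <> h0 \/ hs i = w0.
  by apply/(removal_boundary v_indep v_min uH Hh0 minh0); apply: Ths.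
case: (classic (exists j, hs j = w0)) => [[j hj]|nj]; last first.
  by apply: ai p p0 => // i; case: (bdh i) => [[]|e] //; case: nj; exists i.
have hN i : i != j -> init_boundary v H (hs i) /\ hs i <> h0.
  by move=> ij; case: (bdh i) => // e; case/eqP: ij; apply: ihs; rewrite e.
have topE : w0 + v ord_max = h0 by rewrite /w0 subrK.
have old i : init_boundary v H (w0 + v i) by apply: removal_old.
have bd_h0 : init_boundary v H h0 by rewrite -topE.
have oldN (i : 'I_n.+1) : i != ord_max -> w0 + v i <> h0.
  move=> im; rewrite -topE => /addrI /v_inj e; by rewrite e eqxx in im.
(* The old variables other than X that occur: those of the relation and those among the arguments of
   Phi. They give the coefficient ring [{mpoly R[l]}], over which X is transcendental. *)
pose s := [seq hs i | i <- enum 'I_k & i != j] ++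
          [seq w0 + v i | i <- enum 'I_n.+1 & i != ord_max].
have sP g : g \in s -> init_boundary v H g /\ g <> h0.
  rewrite mem_cat => /orP [] /mapP [i]; rewrite mem_filter => /andP [iN _] ->; first exact: hN.
  by split=> //; apply: oldN.
have [l [u [iu us cu]]] := seq_cover s.
have [a ha] : exists a : 'I_k -> {mpoly R[l]},
    forall i, i != j -> exists2 t, a i = 'X_t & u t = hs i.
  apply: (fun_choice (Q := fun i (x : {mpoly R[l]}) =>
    i != j -> exists2 t, x = 'X_t & u t = hs i)) => i.
  have [->|ij] := eqVneq i j; first by exists 0.
  have [|t ut] := cu (hs i); last by exists 'X_t => _; exists t.
  by rewrite mem_cat map_f // mem_filter ij mem_enum.
have [b hb] : exists b : 'I_n.+1 -> {mpoly R[l]},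
    forall i, i != ord_max -> exists2 t, b i = 'X_t & u t = w0 + v i.
  apply: (fun_choice (Q := fun i (x : {mpoly R[l]}) =>
    i != ord_max -> exists2 t, x = 'X_t & u t = w0 + v i)) => i.
  have [->|ij] := eqVneq i ord_max; first by exists 0.
  have [|t ut] := cu (w0 + v i); last by exists 'X_t => _; exists t.
  by rewrite mem_cat orbC (map_f (fun i => w0 + v i)) // mem_filter ij mem_enum.
pose evD : {rmorphism {mpoly R[l]} -> F} := mmap iR (f \o u).
have eva i : i != j -> evD (a i) = f (hs i).
  by move=> /ha [t -> ut]; rewrite /evD /= mmapX_var /= ut.
have evb i : i != ord_max -> evD (b i) = f (w0 + v i).
  by move=> /hb [t -> ut]; rewrite /evD /= mmapX_var /= ut.
pose cc : {rmorphism R -> {poly {mpoly R[l]}}} := polyC \o @mpolyC l R.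
have evinj (q : {poly {mpoly R[l]}}) : (map_poly evD q).[f h0] = 0 -> q = 0.
  have [mu muniK muK] := @muni_bij l R.
  rewrite -(muK q) => e; rewrite (_ : mu q = 0) ?rmorph0 //.
  pose u' i := if unlift ord_max i is Some t then u t else h0.
  have u'w t : u' (widen t) = u t.
    by rewrite -lift_ord_max /u' liftK.
  have u'm : u' ord_max = h0 by rewrite /u' unlift_none.
  apply: (ai _ u').
  - move=> i1 i2; rewrite /u'; case: unliftP => [t1 ->|->]; case: unliftP => [t2 ->|->] //.
    + by move=> /iu ->.
    + by move=> e'; case: (sP _ (us t1)) => _ [].
    + by move=> e'; case: (sP _ (us t2)) => _ []; rewrite e'.
  - move=> i; rewrite /u'; case: unliftP => [t _|_ //]; exact: (sP _ (us t)).1.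
  rewrite mmap_muni /= u'm -[RHS]e; congr (_.[_]); apply: eq_map_poly => r.
  by apply: eq_bigr => m _; congr (_ * _); apply: mmap1_eq => t /=; rewrite u'w.
(* This turns [p] into a univariate polynomial in its [j]-th variable. At [f w0] it gives the
   assumed relation; at [f h0] it would give one between old variables, so it is nonzero when [p]
   is. *)
pose vp c i : {poly {mpoly R[l]}} := if i == j then c else (a i)%:P.
have evpi c : (map_poly evD (mmap cc (vp 'X) p)).[c] =
    mmap iR (fun i => if i == j then c else f (hs i)) p.
  move: (p); apply: (@mpoly_rmorph_ext _ _ _
    (horner_eval c \o map_poly evD \o mmap cc (vp 'X))
    (mmap iR (fun i => if i == j then c else f (hs i)))) => [r|i] /=.
    by rewrite !mmapC /cc /= map_polyC horner_evalE /= hornerC /evD /= mmapC.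
  rewrite !mmapX_var horner_evalE /vp; case: eqVneq => [_|ij]; first by rewrite map_polyX hornerX.
  by rewrite map_polyC hornerC /= -[LHS]/(evD (a i)) eva.
have pi0 : mmap cc (vp 'X) p = 0 -> p = 0.
  move=> e; pose hs' i := if i == j then h0 else hs i.
  apply: (ai _ hs').
  - move=> i1 i2; rewrite /hs'; case: eqVneq => [->|i1j]; case: eqVneq => [-> //|i2j].
    + by move=> e'; case: (hN _ i2j) => _ /(_ (esym e')).
    + by move=> e'; case: (hN _ i1j).
    exact: ihs.
  - by move=> i; rewrite /hs'; case: eqVneq => // /hN [].
  transitivity ((map_poly evD (mmap cc (vp 'X) p)).[f h0]); last by rewrite e rmorph0 horner0.
  rewrite evpi; apply: eq_bigr => m _; congr (_ * _); apply: mmap1_eq => i /=.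
  by rewrite /hs'; case: eqP.
apply: pi0; apply: NNPP => /eqP pi0.
pose phi : {poly {mpoly R[l]}} := mmap cc (fun i => if i == ord_max then 'X else (b i)%:P) P.
pose M := \prod_(i < n) b (widen i) ^+ mP (widen i).
have wN i : widen i != ord_max :> 'I_n.+1 by rewrite -val_eqE /= ltn_eqF.
have evphi : (map_poly evD phi).[f h0] = mmap iR (fun i => f (w0 + v i)) P.
  rewrite /phi; move: (P); apply: (@mpoly_rmorph_ext _ _ _
    (horner_eval (f h0) \o map_poly evD \o mmap cc (fun i => if i == ord_max then 'X else (b i)%:P))
    (mmap iR (fun i => f (w0 + v i)))) => [r|i] /=.
    by rewrite !mmapC /cc /= map_polyC horner_evalE /= hornerC /evD /= mmapC.
  rewrite !mmapX_var horner_evalE; case: eqVneq => [->|iN]; first by rewrite map_polyX hornerX topE.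
  by rewrite map_polyC hornerC /= -[LHS]/(evD (b i)) evb.
have eM : evD M * f h0 ^+ mP ord_max = mmap1 (fun i => f (w0 + v i)) mP.
  rewrite /mmap1 big_ord_recr /= topE rmorph_prod; congr (_ * _).
  by apply: eq_bigr => i _; rewrite rmorphXn /= evb.
have eW : f w0 * (evD M * f h0 ^+ mP ord_max) = (map_poly evD phi).[f h0].
  by rewrite eM evphi fw0 lpevalK // => i; apply: f0.
have M0 : M != 0.
  apply: contraTneq (isT : true) => M0; have : mmap1 (fun i => f (w0 + v i)) mP != 0.
    by apply: mmap1_neq0 => i; apply: f0.
  by rewrite -eM M0 rmorph0 mul0r eqxx.
have piW : (map_poly evD (mmap cc (vp 'X) p)).[f w0] = 0.
  rewrite evpi -[RHS]p0; apply: eq_bigr => m _; congr (_ * _); apply: mmap1_eq => i /=.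
  by case: eqP => // ->; rewrite hj.
have [c ec] := poly_fun_transcendental evinj eW M0 piW pi0.
pose b' : 'I_n -> {mpoly R[l]} := b \o widen.
have ephi : phi = map_poly (mmap (@mpolyC l R) b') (muni P).
  rewrite /phi; move: (P); apply: (@mpoly_rmorph_ext _ _ _
    (mmap cc (fun i => if i == ord_max then 'X else (b i)%:P))
    (map_poly (mmap (@mpolyC l R) b') \o @muni n R)) => [r|i] /=.
    by rewrite mmapC muniC map_polyC /= mmapC.
  rewrite mmapX_var; case: (unliftP ord_max i) => [j' ->|->]; last first.
    by rewrite eqxx muni_ordmax map_polyX.
  by rewrite lift_ord_max (negbTE (wN j')) muni_widen map_polyC /= mmapX_var.
(* The points [w0 + v (widen i)] are distinct old boundary points, so a vanishing coefficient of
   [phi] comes from a vanishing coefficient of [muni P]. *)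
have binj (q : {mpoly R[n]}) : mmap (@mpolyC l R) b' q = 0 -> q = 0.
  move=> e; apply: (ai _ (fun i => w0 + v (widen i))).
  - by move=> i1 i2 /addrI /v_inj /(congr1 val) /= e'; apply: val_inj.
  - by move=> i; apply: old.
  rewrite -[RHS](rmorph0 evD) -e.
  move: (q); apply: (@mpoly_rmorph_ext _ _ _ (mmap iR (f \o (fun i => w0 + v (widen i))))
    (evD \o mmap (@mpolyC l R) b')) => [r|i] /=.
    by rewrite !mmapC.
  by rewrite !mmapX_var -[RHS]/(evD (b (widen i))) evb.
apply: (depends_on_ordmax dep (c := (muni P)`_(mP ord_max))).
apply/polyP => t; rewrite mul_polyC coefZ coefXn; case: eqP => [->|nt]; first by rewrite mulr1.
rewrite mulr0; apply: binj; have := congr1 (fun r : {poly {mpoly R[l]}} => r`_t) ec.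
by rewrite ephi coef_map /= coefCM coefXn; case: eqP => // _; rewrite mulr0.
Qed.
End IndependenceStep.

(** * Rational identities evaluated at independent values *)

Section FractionLift.
Variables (D : idomainType) (F : fieldType) (phi : {rmorphism D -> F}).
Hypothesis phi_inj : injective phi.

Lemma fraction_repr (x : {fraction D}) : exists nd : D * D, nd.2 != 0 /\ x = nd.1%:F / nd.2%:F.
Proof.
elim/quotW: x => r; have r0 := denom_ratioP r.
exists (frac r); split=> //; rewrite -[LHS](mulfK (_ : (frac r).2%:F != 0)); last first.
  by rewrite tofrac_eq0.
congr (_ / _); unlock FracField.tofrac; rewrite -[LHS]FracField.pi_mul.
apply/eqmodP; rewrite /= FracField.equivfE /FracField.mulf !numden_Ratio ?mulf_neq0 ?oner_neq0 //.
by rewrite !mulr1 mulrC.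
Qed.

(** Psi is given by an identity in the fraction field of a polynomial ring. Lifting an injective
    evaluation to that field lets the identity, and irreducibility of Laurent polynomials, be read
    in [F]. *)
Lemma fraction_lift : exists j : {rmorphism {fraction D} -> F}, forall d, j d%:F = phi d.
Proof.
have [nd hnd] := fun_choice fraction_repr.
pose j x := phi (nd x).1 / phi (nd x).2.
have phi0 d : (phi d == 0) = (d == 0) by rewrite -(inj_eq phi_inj) rmorph0.
have jE a b : b != 0 -> j (a%:F / b%:F) = phi a / phi b.
  move=> b0; have [d0] := hnd (a%:F / b%:F); rewrite /j; case: (nd _) d0 => p q /= q0 e.
  apply/eqP; rewrite eqr_div ?phi0 // -!rmorphM; apply/eqP; congr (phi _); apply/eqP.
  by rewrite -tofrac_eq !tofracM -eqr_div ?tofrac_eq0 // -e.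
have jadd : zmod_morphism j.
  move=> x y; have [] := hnd x; have [] := hnd y; case: (nd x) => a b; case: (nd y) => c d /=.
  move=> d0 -> b0 ->; rewrite -mulNr addf_div ?tofrac_eq0 // -!tofracN -!tofracM -tofracD.
  rewrite !jE ?mulf_neq0 // -mulNr addf_div ?phi0 //.
  by rewrite !rmorphD !rmorphM !rmorphN.
have jmul : monoid_morphism j.
  split; first by rewrite -[X in j X]divr1 -tofrac1 jE ?oner_neq0 // rmorph1 divr1.
  move=> x y; have [] := hnd x; have [] := hnd y; case: (nd x) => a b; case: (nd y) => c d /=.
  move=> d0 -> b0 ->; rewrite mulf_div -!tofracM !jE ?mulf_neq0 // !rmorphM mulf_div //.
pose A := GRing.isZmodMorphism.Build _ _ j jadd.
pose B := GRing.isMonoidMorphism.Build _ _ j jmul.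
pose jm : {rmorphism {fraction D} -> F} := HB.pack j A B.
by exists jm => d; rewrite /= -[X in j X]divr1 -tofrac1 jE ?oner_neq0 // rmorph1 divr1.
Qed.
End FractionLift.

Section Transfer.
Variables (R : idomainType) (F : fieldType) (iota : {rmorphism {fraction R} -> F}).
Variables (n : nat) (u : 'I_n.+1 -> F).
Local Notation iR := (iotaR iota).
Hypothesis u_inj : forall p, mmap iR u p = 0 -> p = 0.

Let u_inj' : injective (mmap iR u).
Proof.
by move=> p q e; apply/eqP; rewrite -subr_eq0; apply/eqP/u_inj; rewrite rmorphB /= e subrr.
Qed.

Lemma rmorph_lpeval (S S' : fieldType) (j : {rmorphism S -> S'}) (g : R -> S) (w : 'I_n.+1 -> S)
  (P : {mpoly R[n.+1]}) m :
  j (lpeval g w P m) = lpeval (j \o g) (j \o w) P m.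
Proof.
rewrite /lpeval fmorph_div rmorph_sum /= rmorph_prod; congr (_ / _).
  apply: eq_bigr => a _; rewrite rmorphM rmorph_prod; congr (_ * _).
  by apply: eq_bigr => i _; rewrite rmorphXn.
by apply: eq_bigr => i _; rewrite rmorphXn.
Qed.

Lemma Psi_identity (P : {mpoly R[n.+1]}) mP (Q : {mpoly R[n.+1]}) mQ : Psi_hyps P mP Q mQ ->
  lpeval iR (fun i => if i == ord_max then lpeval iR u P mP else u i) Q mQ = u ord_max.
Proof.
case=> _ e; have [j jE] := fraction_lift u_inj'.
transitivity (j ('X_ord_max : {mpoly R[n.+1]})%:F); last by rewrite jE /= mmapX_var.
rewrite -e rmorph_lpeval.
transitivity (lpeval iR (j \o (fun i : 'I_n.+1 =>
       if i == ord_max then PhiF P mP else ('X_i : {mpoly R[n.+1]})%:F)) Q mQ).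
  apply: lpeval_eq => i /=; case: ifP => _; last by rewrite jE /= mmapX_var.
  by rewrite /PhiF /lpfrac fmorph_div !jE /= mmapX.
congr (_ / _); apply: eq_bigr => m _; congr (_ * _).
by rewrite /= jE /= mmapC.
Qed.

Variables (L : zmodType) (f : L -> F) (hs : 'I_n.+1 -> L).
Hypothesis uE : forall i, u i = f (hs i).
Let T g := exists i, hs i = g.

Let u0 i : u i != 0.
Proof.
apply/eqP => ui; have : mmap iR u 'X_i = 0 by rewrite mmapX_var.
by move/u_inj/mpolyP/(_ U_(i)%MM); rewrite mcoeffX eqxx mcoeff0 => /eqP; rewrite oner_eq0.
Qed.

Lemma irreducible_transfer (Q : {mpoly R[n.+1]}) mQ :
  irreducible_in (@laurentN R n.+1) (PhiF Q mQ) ->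
  irreducible_in (laurent_ring iota f T) (lpeval iR u Q mQ).
Proof.
have [j jE] := fraction_lift u_inj'.
have jl P m : j (lpfrac P m) = lpeval iR u P m.
  by rewrite /lpfrac fmorph_div !jE /= mmapX.
have f0 : nz f T by move=> _ [i <-]; rewrite -uE.
have LRP P m : laurent_ring iota f T (lpeval iR u P m).
  exists n.+1, hs, P, m; split=> [i|]; first by exists i.
  by apply: lpeval_eq.
have LRT a : laurent_ring iota f T a -> exists P m, a = lpeval iR u P m.
  move=> Ta; have [s sT h] := laurent_cover f0 Ta.
  have [||P [m ->]] := h _ hs; [by move=> i; exists i|by move=> g /sT|].
  by exists P, m; apply: lpeval_eq => i /=; rewrite uE.
case=> _ [Q0 Qirr]; split; first exact: LRP.
split; first by rewrite -jl fmorph_eq0; apply: Q0.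
have unit_tr P m : unit_in (@laurentN R n.+1) (lpfrac P m) ->
    unit_in (laurent_ring iota f T) (lpeval iR u P m).
  case=> _ [_ [[P' [m' ->]] e]]; split; first exact: LRP.
  by exists (lpeval iR u P' m'); split=> //; rewrite -!jl -rmorphM e rmorph1.
move=> b c /LRT [B [mb ->]] /LRT [C [mc ->]] e.
case: (Qirr (lpfrac B mb) (lpfrac C mc)); first by exists B, mb.
- by exists C, mc.
- apply: (fmorph_inj j); rewrite [RHS]rmorphM /PhiF !jl; exact: e.
- by left; apply: unit_tr.
by right; apply: unit_tr.
Qed.
End Transfer.

(** * Units are monomials *)

(** Write both factors as a power of the variable times a polynomial not vanishing at 0. Comparing
    orders at 0, the latter multiply to the constant [a], so both are constant. *)
Lemma poly_monomial_factor (D : idomainType) (p q : {poly D}) a t :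
  a != 0 -> p * q = a%:P * 'X^t ->
  exists b b' i, p = b%:P * 'X^i /\ b * b' = a.
Proof.
move=> a0 e.
have X0 k : 'X^k != 0 :> {poly D} by rewrite monic_neq0 // monicXn.
have pq0 : p * q != 0 by rewrite e mulf_neq0 // polyC_eq0.
have p0 : p != 0 by apply: contraNneq pq0 => ->; rewrite mul0r.
have q0 : q != 0 by apply: contraNneq pq0 => ->; rewrite mulr0.
have [i [p1]] := multiplicity_XsubC p 0; rewrite p0 polyC0 subr0 /= => p1r ep.
have [j [q1]] := multiplicity_XsubC q 0; rewrite q0 polyC0 subr0 /= => q1r eq.
have n0 : (p1 * q1).[0] != 0 by rewrite hornerM mulf_neq0.
have e' : (p1 * q1) * 'X^(i + j) = a%:P * 'X^t by rewrite -e ep eq exprD; ring.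
have X00 k : ('X^(k.+1) : {poly D}).[0] = 0 by rewrite hornerXn expr0n.
have ijt : (i + j)%N = t.
  case: (ltngtP (i + j) t) => // ijt.
    have : p1 * q1 = a%:P * 'X^((t - (i + j)).-1.+1).
      apply: (mulIf (X0 (i + j)%N)); rewrite e' -mulrA -exprD; congr (_ * 'X^_); lia.
    by move=> e1; move: n0; rewrite e1 hornerM X00 mulr0 eqxx.
  have : p1 * q1 * 'X^((i + j - t).-1.+1) = a%:P.
    apply: (mulIf (X0 t)); rewrite -e' -[LHS]mulrA -exprD; congr (_ * 'X^_); lia.
  by move/(congr1 (horner^~ 0)); rewrite hornerM X00 mulr0 hornerC => a0'; rewrite -a0' eqxx in a0.
have {}e' : p1 * q1 = a%:P by apply: (mulIf (X0 t)); rewrite -{1}ijt e'.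
have p10 : p1 != 0 by apply: contraNneq p0 => p10; rewrite ep p10 mul0r.
have q10 : q1 != 0 by apply: contraNneq q0 => q10; rewrite eq q10 mul0r.
have sz : (size p1 + size q1).-1 = 1%N by rewrite -size_mul // e' size_polyC a0.
have sp1 : size p1 = 1%N by move: p10 q10 sz; rewrite -!size_poly_eq0 /=; lia.
have sq1 : size q1 = 1%N by move: p10 q10 sz; rewrite -!size_poly_eq0 /=; lia.
have ep1 := size1_polyC (eq_leq sp1); have eq1 := size1_polyC (eq_leq sq1).
exists p1`_0, q1`_0, i; split; first by rewrite {1}ep {1}ep1.
by apply: polyC_inj; rewrite polyCM -ep1 -eq1.
Qed.

Lemma mpoly_monomial_factor (R : idomainType) k (A B : {mpoly R[k]}) c m :
  c != 0 -> A * B = c *: 'X_[m] -> exists c' m', c' != 0 /\ A = c' *: 'X_[m'].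
Proof.
elim: k A B c m => [|k IH] A B c m c0 e.
  have A0 : A != 0.
    apply: contraTneq (isT : true) => A0; have /mpolyP /(_ m) := e.
    by rewrite A0 mul0r mcoeff0 mcoeffZ mcoeffX eqxx mulr1 => /esym /eqP; rewrite (negbTE c0).
  exists A@_0, 0%MM; have eA : A = A@_0 *: 'X_[0].
    apply/mpolyP => m'; have -> : m' = 0%MM by apply/mnmP => -[? ?].
    by rewrite mcoeffZ mcoeffX eqxx mulr1.
  by split=> //; apply: contraNneq A0 => A00; rewrite eA A00 scale0r.
have eX (x : 'X_{1..k.+1}) : 'X_[x] =
    mwiden 'X_[[multinom x (widen i) | i < k]] * 'X_ord_max ^+ x ord_max :> {mpoly R[k.+1]}.
  rewrite mwidenX mpolyXn -mpolyXD; congr 'X_[_]; apply/mnmP => i; rewrite mnmDE mulmnE mnm1E.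
  case: (unliftP ord_max i) => [j ->|->].
    by rewrite lift_ord_max mnmwiden_widen mnmE -val_eqE /= gtn_eqF ?muln0 ?mul0n ?addn0.
  by rewrite mnmwiden_ordmax eqxx mul1n.
have e' : muni A * muni B =
    (c *: 'X_[[multinom m (widen i) | i < k]] : {mpoly R[k]})%:P * 'X^(m ord_max).
  rewrite -rmorphM e eX -mul_mpolyC !rmorphM rmorphXn /= muniC muni_mwiden muni_ordmax.
  by rewrite mulrA -polyCM mul_mpolyC.
have cX0 : c *: 'X_[[multinom m (widen i) | i < k]] != 0 :> {mpoly R[k]}.
  apply/eqP => /mpolyP /(_ [multinom m (widen i) | i < k]).
  rewrite mcoeffZ mcoeffX eqxx mulr1 mcoeff0.
  by apply/eqP.
have [b [b' [i [eA bb']]]] := poly_monomial_factor cX0 e'.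
have [c1 [m1 [c10 eb]]] := IH _ _ _ _ c0 bb'.
exists c1, (mnmwiden m1 + U_(ord_max) *+ i)%MM; split=> //.
apply: (bij_inj (@muni_bij k R)); rewrite eA eb mpolyXD -mwidenX -mpolyXn.
rewrite -!mul_mpolyC !rmorphM rmorphXn /= muniC muni_mwiden muni_ordmax.
by rewrite mulrA -polyCM.
Qed.

Section UnitMonomial.
Variables (R : idomainType) (F : fieldType) (iota : {rmorphism {fraction R} -> F}).
Variables (L : zmodType) (f : L -> F) (T : L -> Prop).
Local Notation iR := (iotaR iota).
Local Notation LR := (laurent_ring iota f T).
Hypothesis ai : alg_independent_on iota f T.

(** The numerators of a unit and of its inverse multiply to a monomial, so each is one.
    Cross-multiplication keeps exponents nonnegative, and the freedom in [hs] lets several units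
    share one list. *)
Lemma unit_monomial a : unit_in LR a -> exists2 s : seq L, (forall g, g \in s -> T g) &
  forall k (hs : 'I_k -> L), injective hs -> (forall i, T (hs i)) ->
    (forall g, g \in s -> exists i, hs i = g) ->
    exists c m m', c != 0 /\ a * mmap1 (f \o hs) m' = iR c * mmap1 (f \o hs) m.
Proof.
have f0 := alg_independent_nz ai.
case=> Ta [b [Tb ab]].
have [s sT h] := laurent_cover f0 Ta; have [s' sT' h'] := laurent_cover f0 Tb.
exists (s ++ s') => [g|k hs ihs Ths cov]; first by rewrite mem_cat => /orP [/sT|/sT'].
have fh0 i : (f \o hs) i != 0 by apply: f0.
have [|A [m eA]] := h k hs Ths; first by move=> g gs; apply: cov; rewrite mem_cat gs.
have [|B [m' eB]] := h' k hs Ths; first by move=> g gs; apply: cov; rewrite mem_cat gs orbT.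
have e : A * B = 1 *: 'X_[m + m'].
  apply: (mmap_inj ai ihs Ths); rewrite scale1r rmorphM /= mmapX (mmap1D iota).
  rewrite -(lpevalK iota fh0 A m) -(lpevalK iota fh0 B m') -eA -eB.
  by rewrite mulrACA ab mul1r.
have [c [m1 [c0 eA']]] := mpoly_monomial_factor (oner_neq0 R) e.
exists c, m1, m; split=> //.
by rewrite eA (lpevalK iota fh0) eA' mmapZ /= mmapX.
Qed.

(** Monomials in the [u i] are Laurent monomials in the variables, and distinct ones have distinct
    exponents: otherwise two would be proportional, against independence of the [u i]. So no terms
    of [P] merge, and a monomial value forces a single term. *)
Lemma units_monomial (n : nat) (u : 'I_n -> F) (P : {mpoly R[n]}) :
  (forall p, mmap iR u p = 0 -> p = 0) -> (forall i, unit_in LR (u i)) ->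
  unit_in LR (mmap iR u P) -> exists c a, P = c *: 'X_[a].
Proof.
have f0 := alg_independent_nz ai.
move=> u_inj uu uP.
have [S hS] := fun_choice
  (fun i => let: ex_intro2 s p q := unit_monomial (uu i) in ex_intro _ s (conj p q)).
have [s0 s0T h0] := unit_monomial uP.
have [k [hs [ihs hss cov]]] := seq_cover (s0 ++ flatten [seq S i | i <- enum 'I_n]).
have Ths j : T (hs j).
  have := hss j; rewrite mem_cat => /orP [/s0T //|/flattenP [t /mapP [i _ ->]]].
  by apply: (hS i).1.
pose y := f \o hs.
have [c0 [al0 [be0 [c00 e0]]]] := h0 k hs ihs Ths (fun g gs => cov g ltac:(by rewrite mem_cat gs)).
have hu i : exists x : R * ('X_{1..k} * 'X_{1..k}),
    x.1 != 0 /\ u i * mmap1 y x.2.2 = iR x.1 * mmap1 y x.2.1.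
  have [|c [m [m' e]]] := (hS i).2 k hs ihs Ths; last by exists (c, (m, m')).
  move=> g gs; apply: cov; rewrite mem_cat; apply/orP; right; apply/flattenP.
  by exists (S i) => //; apply: map_f; rewrite mem_enum.
have {hu} [x hx] := fun_choice hu.
pose ma (a : 'X_{1..n}) := (\sum_(i < n) (x i).2.1 *+ a i)%MM.
pose mb (a : 'X_{1..n}) := (\sum_(i < n) (x i).2.2 *+ a i)%MM.
pose mc (a : 'X_{1..n}) := \prod_(i < n) (x i).1 ^+ a i.
have y1_sum (z : 'I_n -> 'X_{1..k}) (a : 'X_{1..n}) :
    mmap1 y (\sum_(i < n) z i *+ a i)%MM = \prod_(i < n) mmap1 y (z i) ^+ a i.
  rewrite -(mmapX y iR) -mprodXnE rmorph_prod; apply: eq_bigr => i _.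
  by rewrite rmorphXn /= mmapX.
have ua a : mmap1 u a * mmap1 y (mb a) = iR (mc a) * mmap1 y (ma a).
  rewrite !y1_sum rmorph_prod {1}/mmap1 -!big_split; apply: eq_bigr => i _.
  by rewrite /= rmorphXn /= -!exprMn (hx i).2.
have mc0 a : mc a != 0.
  by apply/prodf_neq0 => i _; rewrite expf_neq0 // (hx i).1.
have y0 m : mmap1 y m != 0 by apply: mmap1_neq0 => i; apply: f0.
(* [E] is a common denominator for the monomials of [P] and [be0] the denominator of the value of
   [P]; [e a] is the exponent of the term [a] once both are cleared. *)
pose E := (\sum_(a <- msupp P) mb a)%MM.
pose Ea a := (\sum_(b <- rem a (msupp P)) mb b)%MM.
have EaE a : a \in msupp P -> E = (mb a + Ea a)%MM by move=> aP; rewrite /E (big_rem a).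
pose e a := (ma a + Ea a + be0)%MM.
have uE a : a \in msupp P -> mmap1 u a * mmap1 y (E + be0)%MM = iR (mc a) * mmap1 y (e a).
  by move=> aP; rewrite (EaE a aP) !(mmap1D iota) !mulrA ua.
clearbody mc e E.
have main : \sum_(a <- msupp P) (P@_a * mc a) *: 'X_[e a] = c0 *: 'X_[al0 + E].
  apply: (mmap_inj ai ihs Ths); rewrite rmorph_sum /= mmapZ /= mmapX (mmap1D iota) mulrA -e0.
  rewrite -mulrA -(mmap1D iota) addmC mulr_suml; apply: eq_big_seq => a aP.
  by rewrite mmapZ /= mmapX -mulrA uE // rmorphM mulrA.
have e_inj a b : a \in msupp P -> b \in msupp P -> e a = e b -> a = b.
  move=> aP bP eab; have : mmap iR u (mc b *: 'X_[a] - mc a *: 'X_[b]) = 0.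
    rewrite rmorphB /= !mmapZ /= !mmapX; apply: (mulIf (y0 (E + be0)%MM)).
    rewrite mul0r mulrBl -(mulrA _ (mmap1 u a)) -(mulrA _ (mmap1 u b)) (uE a aP) (uE b bP) eab.
    by rewrite mulrCA subrr.
  move/u_inj/mpolyP/(_ a); rewrite mcoeffB !mcoeffZ !mcoeffX eqxx mulr1 mcoeff0.
  case: eqP => [<- _ //|_].
  by rewrite mulr0 subr0 => /eqP; rewrite (negbTE (mc0 b)).
have all_e0 a : a \in msupp P -> e a = (al0 + E)%MM.
  move=> aP; have /mpolyP /(_ (e a)) := main; rewrite mcoeffZ mcoeffX raddf_sum /=.
  rewrite (bigD1_seq a aP (msupp_uniq P)) /= mcoeffZ mcoeffX eqxx mulr1 big_seq_cond.
  rewrite big1 => [|b /andP [bP ba]].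
    rewrite addr0; case: eqP => [<- _ //|_]; rewrite mulr0 => /eqP.
    rewrite mulf_eq0 (negbTE (mc0 a)) orbF.
    by rewrite mcoeff_eq0 aP.
  rewrite mcoeffZ mcoeffX; case: eqP => [/e_inj e'|_]; last by rewrite mulr0.
  by rewrite e' ?eqxx // in ba.
case eP: (msupp P) => [|a r].
  by exists 0, 0%MM; rewrite scale0r; apply/eqP; rewrite -msupp_eq0 eP.
have aP : a \in msupp P by rewrite eP mem_head.
exists P@_a, a; rewrite [LHS]mpolyE (bigD1_seq a) ?msupp_uniq //= big_seq_cond.
rewrite big1 ?addr0 // => b /andP [bP ba].
by case/eqP: ba; apply: e_inj => //; rewrite !all_e0.
Qed.
End UnitMonomial.

(** * Removing one point from a domain *)

Lemma classical_filter (T : eqType) (D : seq T) (A : T -> Prop) :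
  exists2 s : seq T, (forall g, g \in s -> A g) & forall g, g \in D -> A g -> g \in s.
Proof.
elim: D => [|d D [s sA h]]; first by exists [::].
case: (classic (A d)) => Ad.
  exists (d :: s) => g; rewrite !inE => /orP [/eqP ->|]; rewrite ?eqxx //; first exact: sA.
  by move=> gD Ag; rewrite h ?orbT.
by exists s => // g; rewrite inE => /orP [/eqP ->|/h].
Qed.

Section PrimeIn.
Variables (R : idomainType) (F : fieldType) (iota : {rmorphism {fraction R} -> F}).
Variables (L : zmodType) (y : L -> F) (T : L -> Prop).
Local Notation S := (laurent_ring iota y T).
Hypothesis y0 : nz y T.

Lemma laurent_finite_all (I : eqType) (D : seq I) (g : I -> F) (A : I -> Prop) :
  (forall d, A d -> S (g d)) ->
  exists2 s : seq L, (forall h, h \in s -> T h) &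
    forall d, d \in D -> A d -> laurent_ring iota y (fun h => h \in s) (g d).
Proof.
move=> Sg; elim: D => [|d D [s sT hs]]; first by exists [::].
have sub (s1 s2 : seq L) a : {subset s1 <= s2} ->
    laurent_ring iota y (fun h => h \in s1) a -> laurent_ring iota y (fun h => h \in s2) a.
  by move=> s12; apply: laurent_sub => h; apply: s12.
case: (classic (A d)) => [/Sg /laurent_finite [s1 s1T h1]|nA].
  exists (s1 ++ s) => [h|e]; first by rewrite mem_cat => /orP [/s1T|/sT].
  rewrite inE => /orP [/eqP -> _|eD Ae].
    by apply: sub h1 => h hs1; rewrite mem_cat hs1.
  by apply: sub (hs e eD Ae) => h hs1; rewrite mem_cat hs1 orbT.
by exists s => // e; rewrite inE => /orP [/eqP -> //|/hs].
Qed.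

Lemma dvd_in_trans1 a b : dvd_in S a 1 -> S b -> dvd_in S a b.
Proof.
move=> [c [Sc e]] Sb; exists (c * b).
by split; [exact: laurentM|rewrite mulrA -e mul1r].
Qed.

Lemma dvd_in1_unit a : S a -> dvd_in S a 1 -> unit_in S a.
Proof. by move=> Sa [c [Sc e]]; split=> //; exists c. Qed.

(** The alternative [dvd_in S p 1] accounts for the empty product, as [p] may be a unit. *)
Lemma qprime_in_mmap1 p k (A : 'I_k -> F) m : qprime_in S p -> (forall i, S (A i)) ->
  dvd_in S p (mmap1 A m) -> dvd_in S p 1 \/ exists i, dvd_in S p (A i).
Proof.
move=> [Sp p0 pp] SA.
have mul a b : S a -> S b -> dvd_in S p (a * b) -> dvd_in S p a \/ dvd_in S p b.
  by move=> Sa Sb [c [Sc e]]; apply: pp e.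
have pow i j : dvd_in S p (A i ^+ j) -> dvd_in S p 1 \/ dvd_in S p (A i).
  elim: j => [|j IH]; first by left.
  have Sx : S (A i ^+ j) by apply: laurentX.
  by rewrite exprS => /(mul _ _ (SA i) Sx) [|/IH]; [right|].
suff : forall r : seq 'I_k, dvd_in S p (\prod_(i <- r) A i ^+ m i) ->
    dvd_in S p 1 \/ exists i, dvd_in S p (A i).
  by apply.
elim=> [|i r IH]; first by rewrite big_nil; left.
have Sx : S (A i ^+ m i) by apply: laurentX.
have Sr : S (\prod_(j <- r) A j ^+ m j).
  elim: r {IH} => [|j r IH]; first by rewrite big_nil; exact: laurent1.
  by rewrite big_cons; apply: laurentM => //; apply: laurentX.
by rewrite big_cons => /(mul _ _ Sx Sr) [/pow [|h]|//]; [left|right; exists i].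
Qed.

Lemma qprime_in_cancel p w k c c' : qprime_in S p -> ~ dvd_in S p w -> S w -> S c -> S c' ->
  c * w = p ^+ k * c' -> exists2 d, S d & c = p ^+ k * d.
Proof.
move=> [Sp p0 pp] nw Sw; elim: k c => [|k IH] c Sc Sc' e; first by exists c; rewrite ?expr0 ?mul1r.
have [//||[c1 [Sc1 ec]]|//] := pp c w (p ^+ k * c') Sc Sw.
- by apply: laurentM => //; apply: laurentX.
- by rewrite e exprS mulrA.
have [//|//||d Sd e1] := IH c1.
  by apply: (mulfI p0); rewrite mulrA -ec e exprS mulrA.
by exists d => //; rewrite ec e1 exprS mulrA.
Qed.

(** Each of the [n] factors [p] divides [c] or [d]. This turns a factorization of [a] with [p]
    inverted into one in [S]. *)
Lemma qprime_in_split p a n c d : qprime_in S p -> S a -> S c -> S d -> a * p ^+ n = c * d ->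
  exists c' d' i j, [/\ S c', S d', c = c' * p ^+ i, d = d' * p ^+ j & a = c' * d'].
Proof.
move=> [Sp p0 pp] Sa; elim: n c d => [|n IH] c d Sc Sd e.
  by exists c, d, 0%N, 0%N; rewrite !expr0 !mulr1 in e *.
have Sap : S (a * p ^+ n) by apply: laurentM => //; apply: laurentX.
have [|[c1 [Sc1 ec]]|[d1 [Sd1 ed]]] := pp c d _ Sc Sd Sap.
- by rewrite -e exprS mulrCA.
- have [|c' [d' [i [j [Sc' Sd' ec1 ed ea]]]]] := IH c1 d Sc1 Sd.
    by apply: (mulfI p0); rewrite [RHS]mulrA -ec -e exprS mulrCA.
  by exists c', d', i.+1, j; split=> //; rewrite ec ec1 exprS mulrCA.
have [|c' [d' [i [j [Sc' Sd' ec ed1 ea]]]]] := IH c d1 Sc Sd1.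
  by apply: (mulfI p0); rewrite [RHS]mulrCA -ed -e exprS mulrCA.
by exists c', d', i, j.+1; split=> //; rewrite ed ed1 exprS mulrCA.
Qed.
End PrimeIn.

(** [corr] inverts variables only, so the equation is transported in cross-multiplied form and the
    denominator cancelled at the target. *)
Lemma corr_mmap_eq (R : idomainType) (F : fieldType) (iota : {rmorphism {fraction R} -> F})
    (L : zmodType) (y z : L -> F) (T : L -> Prop) k (a b : 'I_k -> F) P m e e' :
  alg_independent_on iota y T -> nz z T ->
  (forall i, corr iota y z T (a i) (b i)) -> corr iota y z T e e' ->
  (forall i, a i != 0) -> (forall i, b i != 0) ->
  e = lpeval (iotaR iota) a P m -> e' = lpeval (iotaR iota) b P m.
Proof.
move=> ai z0 ab ee' a0 b0 ea; apply: (mulIf (mmap1_neq0 b0 m)); rewrite lpevalK //.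
apply: (corr_fun ai z0 (a := e * mmap1 a m)); first by apply: corrM => //; apply: corr_mmap1.
by rewrite ea lpevalK //; apply: corr_mmap.
Qed.

(** * Restricting and renaming the variables *)

Section Restrict.
Variables (R : idomainType) (F : fieldType) (iota : {rmorphism {fraction R} -> F}).
Variables (L : zmodType) (y : L -> F) (T T' : L -> Prop).
Hypothesis ai : alg_independent_on iota y T'.
Hypothesis TT' : forall g, T g -> T' g.
Local Notation S := (laurent_ring iota y T).
Local Notation S' := (laurent_ring iota y T').

Lemma unit_in_restrict u : S u -> unit_in S' u -> unit_in S u.
Proof.
move=> Su uu; have u0 := unit_in_neq0 uu; case: uu => _ [w [S'w uw]].
split=> //; exists w; split=> //.
apply: (laurent_div ai TT' Su _ u0 S'w (c := 1)); last by rewrite mulrC.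
by apply: laurent1 => g /TT' /(alg_independent_nz ai).
Qed.

Lemma irreducible_in_restrict p : S p -> irreducible_in S' p -> irreducible_in S p.
Proof.
move=> Sp [_ [p0 irr]]; split=> //; split=> // b c Sb Sc e.
have [||//|ub|uc] := irr b c; [exact: laurent_sub Sb|exact: laurent_sub Sc|left|right];
exact: unit_in_restrict.
Qed.

Lemma coprime_in_restrict a b : S a -> S b -> coprime_in S' a b -> coprime_in S a b.
Proof.
move=> Sa Sb [_ [_ cop]]; split=> //; split=> // d Sd [a' [Sa' ea]] [b' [Sb' eb]].
apply: unit_in_restrict => //; apply: cop; first exact: laurent_sub Sd.
  by exists a'; split=> //; apply: laurent_sub Sa'.
by exists b'; split=> //; apply: laurent_sub Sb'.
Qed.
End Restrict.

Section Isomorphism.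
Variables (R : idomainType) (F : fieldType) (iota : {rmorphism {fraction R} -> F}).
Variables (L : zmodType) (y z : L -> F) (T : L -> Prop).
Hypotheses (aiy : alg_independent_on iota y T) (aiz : alg_independent_on iota z T).
Local Notation Sy := (laurent_ring iota y T).
Local Notation Sz := (laurent_ring iota z T).
Local Notation corr := (corr iota y z T).
Let y0 := alg_independent_nz aiy.
Let z0 := alg_independent_nz aiz.

Let back c : Sz c -> exists2 c', Sy c' & corr c' c.
Proof.
move=> /(corr_total y) [c' cc']; exists c'; last exact: corr_sym.
exact: corr_right cc'.
Qed.

Lemma unit_in_corr a b : corr a b -> unit_in Sy a -> unit_in Sz b.
Proof.
move=> ab [_ [a' [Sa' aa']]]; split; first exact: corr_right ab.
have [b' ab'] := corr_total z Sa'; exists b'; split; first exact: corr_right ab'.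
apply: (corr_fun aiy z0 (a := 1)); last exact: corr1.
by rewrite -aa'; apply: corrM.
Qed.

Let corr_mul_eq a b c a' b' c' : corr a a' -> corr b b' -> corr c c' -> a' = b' * c' -> a = b * c.
Proof.
move=> aa' bb' cc' e; apply: (corr_fun aiz y0 (a := a')); first exact: corr_sym.
by rewrite e; apply: corr_sym; apply: corrM.
Qed.

Lemma irreducible_in_corr a b : corr a b -> irreducible_in Sy a -> irreducible_in Sz b.
Proof.
move=> ab [_ [a0 irr]]; split; first exact: corr_right ab.
split.
  apply: contraNneq a0 => b0; rewrite b0 in ab; apply/eqP.
  exact: corr_zero aiz y0 _ (corr_sym ab).
move=> c d /back [c' Sc' cc'] /back [d' Sd' dd'] e.
by have [u|u] := irr _ _ Sc' Sd' (corr_mul_eq ab cc' dd' e); [left|right]; apply: unit_in_corr u.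
Qed.

Lemma coprime_in_corr a a' b b' : corr a a' -> corr b b' ->
  coprime_in Sy a b -> coprime_in Sz a' b'.
Proof.
move=> aa' bb' [_ [_ cop]]; split; first exact: corr_right aa'.
split; first exact: corr_right bb'.
move=> d /back [d' Sd' dd'] [e [/back [e' Se' ee'] ea]] [g [/back [g' Sg' gg'] eb]].
apply: (unit_in_corr dd'); apply: cop => //.
  by exists e'; split=> //; apply: corr_mul_eq ea.
by exists g'; split=> //; apply: corr_mul_eq eb.
Qed.
End Isomorphism.

(** * Persistence of the three properties under removal *)

Section Orbit.
Variables (R : idomainType) (F : fieldType) (iota : {rmorphism {fraction R} -> F}).
Variables (L : zmodType) (n : nat) (v : 'I_n.+1 -> L).
Variables (P : {mpoly R[n.+1]}) (mP : 'X_{1..n.+1}) (Q : {mpoly R[n.+1]}) (mQ : 'X_{1..n.+1}).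
Local Notation iR := (iotaR iota).
Local Notation LR f H := (laurent_ring iota f (init_boundary v H)).
Local Notation vN := (v ord_max).
Hypothesis ufd : UFD R.
Hypothesis v_inj : injective v.
Hypothesis v_gen : generates v.
Hypothesis v_indep : nonneg_independent v.
Hypothesis v_min : forall i, lcle v vN (v i).
Hypothesis PhiH : Phi_hyps P mP.
Hypothesis PsiH : Psi_hyps P mP Q mQ.

(** Boundary values of [f] play the initial variables, so their independence is included. The
    Laurent property is the first component of [irreducible_in]. *)
Definition good (f : L -> F) (H : L -> Prop) : Prop :=
  [/\ alg_independent_on iota f (init_boundary v H),
      forall h, H h -> irreducible_in (LR f H) (f h) &
      forall h1 h2, H h1 -> H h2 -> h1 <> h2 -> coprime_in (LR f H) (f h1) (f h2)].

Variables (Ht : L -> Prop) (f : L -> F).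
Hypothesis lcHt : light_cone_regular v Ht.
Hypothesis fsol : forall h, Ht h -> ~ init_boundary v Ht h ->
  f h = lpeval iR (fun i => f (h + v i)) P mP.
Hypothesis goodHt : good f Ht.

Let uHt : upper v Ht := lcr_upper lcHt.

Lemma orbit_eq h : (forall i, Ht (h + v i)) -> f h = lpeval iR (fun i => f (h + v i)) P mP.
Proof.
move=> Hi; apply: fsol; first by apply: uHt (Hi ord_max) _; apply: lcle_var.
by case=> _ [i]; apply.
Qed.

Lemma orbit_neq0 h : Ht h -> f h != 0.
Proof. by case: goodHt => _ irr _ /irr [_ []]. Qed.

Lemma lcr_finite h : exists s : seq L, forall h', Ht h' -> lcle v h' h -> h' \in s.
Proof.
case: (classic (Ht h)) => [/lcHt.2 [] //|nh].
by exists [::] => h' Hh' h'h; case: nh; apply: uHt h'h.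
Qed.

Lemma good_independent (G : L -> Prop) (s : seq L) : upper v G -> (forall g, G g -> Ht g) ->
  (forall g, Ht g -> ~ G g -> g \in s) -> alg_independent_on iota f (init_boundary v G).
Proof.
apply: (remove_ind v_indep (Pr := fun G => alg_independent_on iota f (init_boundary v G)) uHt).
  by case: goodHt.
move=> {}G h0 uG GHt Gh0 minh0 ai.
apply: (alg_independent_removal (P := P) (mP := mP)) => //; last exact: PhiH.2.2.
apply: orbit_eq => i; apply: GHt.
exact: (removal_old v_min uG Gh0 minh0 i).1.
Qed.

(** Remove from [Ht] the finite cones below all [g + v i + vN]. By [var_sub_notin] no [g + v j] is
    lost, so all lie on the boundary of what remains, where [good_independent] applies. *)
Lemma orbit_independent g : (forall i, Ht (g + v i)) ->
  forall p, mmap iR (fun i => f (g + v i)) p = 0 -> p = 0.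
Proof.
move=> Hg p; pose G a := Ht a /\ forall i, ~ lcle v a (g + v i + vN).
have uG : upper v G.
  move=> a b [Ha na] ab; split; first exact: uHt ab.
  by move=> i bi; apply: (na i); apply: lcle_trans bi.
have [s hs] := fun_choice (fun i => lcr_finite (g + v i + vN)).
have ai : alg_independent_on iota f (init_boundary v G).
  apply: (@good_independent G (flatten [seq s i | i <- enum 'I_n.+1])) => // [a []//|a Ha nG].
  have [i ai] : exists i, lcle v a (g + v i + vN).
    by apply: NNPP => ni; apply: nG; split=> // i ai; apply: ni; exists i.
  by apply/flattenP; exists (s i); [apply: map_f; rewrite mem_enum|apply: hs].
apply: (ai _ (fun i => g + v i)) => [i j /addrI /v_inj //|i].
split; first split=> // j.
  rewrite /lcle -(addrA g (v j)) opprD addrACA subrr add0r.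
  exact: var_sub_notin.
by exists ord_max => - [_ /(_ i)]; apply; apply: lcle_refl.
Qed.

(* If [f] took unit values at [h0 + t1] and at all the [h0 + t1 + v i], these
   values would be Laurent monomials; those at the [h0 + t1 + v i] being
   algebraically independent, [Phi] itself would be a Laurent monomial. *)
Lemma deep_nonunit (D : seq L) h0 : h0 \in D ->
  exists t, (forall d, d \in D -> Ht (d + t)) /\ ~ unit_in (LR f Ht) (f (h0 + t)).
Proof.
move=> h0D; have [[ht Hht] _] := lcHt.
(* [t1] leaves room for one further shift by [vN], the lowest one, so that [t1] and all [t1 + v i]
   carry [D] into [Ht]. *)
have [t1 ht1] := lcle_directed [seq ht - d - vN | d <- D] v_gen.
have deepN d : d \in D -> Ht (d + t1 + vN).
  move=> dD; apply: uHt Hht _; have := ht1 _ (map_f _ dD).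
  rewrite /lcle => h; have -> : ht - (d + t1 + vN) = ht - d - vN - t1; last by [].
  by rewrite !opprD !addrA addrAC.
have deep d i : d \in D -> Ht (d + (t1 + v i)).
  by move=> dD; rewrite addrA; apply: uHt (deepN d dD) _; rewrite ![d + t1 + _]addrC lcle_addr.
have deep1 d : d \in D -> Ht (d + t1).
  by move=> dD; apply: uHt (deepN d dD) _; apply: lcle_var.
apply: NNPP => nt.
have unit_at t : (forall d, d \in D -> Ht (d + t)) -> unit_in (LR f Ht) (f (h0 + t)).
  by move=> Dt; apply: NNPP => nu; apply: nt; exists t.
have ai : alg_independent_on iota f (init_boundary v Ht) by case: goodHt.
have f0 := alg_independent_nz ai.
have ug := unit_at t1 deep1.
have ui i : unit_in (LR f Ht) (f (h0 + t1 + v i)).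
  by rewrite -addrA; apply: unit_at => d; apply: deep.
have Hi i : Ht (h0 + t1 + v i) by rewrite -addrA; apply: deep.
have eg := orbit_eq Hi; have ind := orbit_independent Hi.
have [|c [a eP]] := units_monomial ai (P := P) ind ui.
  rewrite -(@lpevalK _ _ iota _ _ _ P mP) => [|i]; last exact: orbit_neq0.
  rewrite -eg; apply: unit_inM => //.
  rewrite /mmap1; elim/big_rec: _ => [|i b _ ub]; first exact: unit_in1.
  by apply: unit_inM => //; apply: unit_inX.
by apply: PhiH.2.1; exists c, a, mP; rewrite /PhiF eP.
Qed.
Section Step.
Variables (H : L -> Prop) (h0 : L).
Hypotheses (uH : upper v H) (HHt : forall h, H h -> Ht h).
Hypotheses (Hh0 : H h0) (minh0 : forall i, ~ H (h0 + v i)).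
Hypothesis goodH : good f H.
Let H' g := H g /\ g <> h0.
Let w0 := h0 - vN.
Local Notation A := (LR f H).
Local Notation B := (LR f H').

Let aiA : alg_independent_on iota f (init_boundary v H).
Proof. by case: goodH. Qed.

Let bdH' g : init_boundary v H' g <-> (init_boundary v H g /\ g <> h0) \/ g = w0.
Proof. exact: removal_boundary. Qed.

Let topE : w0 + vN = h0.
Proof. exact: removal_top. Qed.

Let h0w0 : h0 <> w0.
Proof. by move=> e; apply: (add_var_neq v_indep (a := w0) (i := ord_max)); rewrite topE e. Qed.

Let old i : init_boundary v H (w0 + v i).
Proof. exact: removal_old. Qed.

Let fw0 : f w0 = lpeval iR (fun i => f (w0 + v i)) P mP.
Proof. by apply: orbit_eq => i; apply: HHt; case: (old i). Qed.

Let aiB : alg_independent_on iota f (init_boundary v H').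
Proof. by apply: (alg_independent_removal (P := P) (mP := mP)) => //; exact: PhiH.2.2. Qed.

Let A0 := alg_independent_nz aiA.
Let B0 := alg_independent_nz aiB.

(** The arguments of Psi: in the equation at [w0] the last argument sits at [w0 + vN = h0], and
    solving for it puts [w0] in that slot. *)
Let q (i : 'I_n.+1) := if i == ord_max then w0 else w0 + v i.

Let q_bd i : init_boundary v H' (q i).
Proof.
rewrite bdH' /q; case: eqVneq => [_|im]; first by right.
left; split; first exact: old.
by rewrite -topE => /addrI /v_inj e; rewrite e eqxx in im.
Qed.

Let q_inj : injective q.
Proof.
move=> i j; rewrite /q; case: eqVneq => [->|im]; case: eqVneq => [->|jm] //.
- by move=> /esym /(add_var_neq v_indep).
- by move=> /(add_var_neq v_indep).
by move=> /addrI /v_inj.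
Qed.

Let fh0 : f h0 = lpeval iR (f \o q) Q mQ.
Proof.
have ind := orbit_independent (fun i => HHt (old i).1).
have := Psi_identity ind PsiH; rewrite -fw0 topE => <-.
by apply: lpeval_eq => i; rewrite /= /q; case: eqP.
Qed.

Let prime_X : qprime_in B (f h0).
Proof.
apply: (irreducible_qprime_in (T := fun g => exists i, q i = g) ufd aiB) => [g [i <-] //|].
have ind p : mmap iR (f \o q) p = 0 -> p = 0 by apply: aiB.
rewrite fh0; exact: (@irreducible_transfer _ _ iota _ _ ind _ f q (fun=> erefl) _ _ PsiH.1).
Qed.

(* A divisibility of [f h] by [f h0] would persist under a translation by [t] into
   [Ht], where [f (h0 + t)] is a prime coprime to all the other values. *)
Lemma step_not_dvd h : H' h ->
  (forall h', H' h' -> lcle v h' h -> B (f h')) -> ~ dvd_in B (f h0) (f h).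
Proof.
move=> H'h lau [c [Bc efh]].
have [D0 hD0] := lcr_finite h.
have H'Ht g : H' g -> Ht g by move=> [/HHt].
have [s1 s1T hs1] := laurent_finite_all (T := init_boundary v H') (g := f) D0
  (A := fun h' => H' h' /\ lcle v h' h) (fun d hd => lau d hd.1 hd.2).
have [s2 s2T hs2] := laurent_finite Bc.
have [s3 s3T hs3] := classical_filter D0 (init_boundary v H').
(* All variables touched by the transport: those of the values below [h], those of the quotient [c],
   the boundary points below [h], and the arguments of Psi. *)
pose s := s1 ++ s2 ++ s3 ++ codom q.
have sT g : g \in s -> init_boundary v H' g.
  by rewrite !mem_cat => /or4P [/s1T|/s2T|/s3T|/codomP [i ->]].
have [t [ht nut]] := @deep_nonunit (h0 :: D0 ++ s) h0 (mem_head _ _).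
have hts g : g \in s -> Ht (g + t) by move=> gs; apply: ht; rewrite in_cons mem_cat gs !orbT.
have htD g : g \in D0 -> Ht (g + t) by move=> gs; apply: ht; rewrite in_cons mem_cat gs !orbT.
have hth0 : Ht (h0 + t) by apply: ht; rewrite mem_head.
pose T g : Prop := g \in s; pose z g := f (g + t).
have z0 : nz z T by move=> g /hts; apply: orbit_neq0.
have aiT : alg_independent_on iota f T by apply: alg_independent_on_sub aiB.
have subT (s' : seq L) a : {subset s' <= s} -> laurent_ring iota f (fun g => g \in s') a ->
    laurent_ring iota f T a.
  by move=> ss'; apply: laurent_sub => g; apply: ss'.
(* [f] and its translate obey the same recursion, so the Laurent expression of [f h'] is carried to
   [f (h' + t)]. *)
have corr_f h' : H' h' -> lcle v h' h -> corr iota f z T (f h') (z h').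
  move=> H'h'; have Hth' := H'Ht _ H'h'; move: h' Hth' H'h'.
  apply: (lcr_ind v_indep lcHt) => h' Hth' IH H'h' h'h.
  have h'D0 := hD0 _ Hth' h'h.
  case: (classic (init_boundary v H' h')) => bh'.
    by apply: corrV; rewrite /T /s !mem_cat hs3 ?orbT.
  have H'i := not_boundaryP H'h' bh'.
  have lei i : lcle v (h' + v i) h by apply: lcle_trans h'h; apply: lcle_var.
  have Tfh' : laurent_ring iota f T (f h').
    by apply: (subT s1) => [g gs1|]; [rewrite /s mem_cat gs1|apply: hs1].
  have [b fb] := corr_total z Tfh'.
  have Hti i : Ht (h' + t + v i).
    by rewrite addrAC; apply: htD; apply: hD0 => //; apply: H'Ht.
  suff -> : z h' = b by [].
  rewrite /z (orbit_eq Hti); apply/esym.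
  apply: (corr_mmap_eq aiT z0 _ fb (a := fun i => f (h' + v i))) => [i|i|i|].
  - rewrite addrAC; apply: IH => //; [exact: H'Ht|exact: lcle_var|exact: add_var_neq].
  - by apply: orbit_neq0; apply: H'Ht.
  - exact: orbit_neq0.
  by apply: orbit_eq => i; apply: H'Ht.
(* [h0] is outside [H'], so the preceding induction does not reach it; Psi is used instead, the
   equation at [w0 + t] having all its arguments in [Ht]. *)
have corr_X : corr iota f z T (f h0) (z h0).
  have Hti i : Ht (w0 + t + v i).
    rewrite addrAC; have [->|im] := eqVneq i ord_max; first by rewrite topE.
    apply: hts; rewrite /s !mem_cat; apply/or4P; apply: Or44; apply/codomP; exists i.
    by rewrite /q (negbTE im).
  have := Psi_identity (orbit_independent Hti) PsiH; rewrite -(orbit_eq Hti).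
  have -> : w0 + t + vN = h0 + t by rewrite addrAC topE.
  move=> e; have -> : z h0 = lpeval iR (z \o q) Q mQ.
    by rewrite {1}/z -e; apply: lpeval_eq => i; rewrite /= /q /z; case: eqP => // _; rewrite addrAC.
  rewrite fh0.
  by apply: corr_lpeval => i; rewrite /T /s !mem_cat codom_f !orbT.
have Tc : laurent_ring iota f T c.
  by apply: subT hs2 => g gs2; rewrite /s !mem_cat gs2 orbT.
have [c' cc'] := corr_total z Tc.
have ezh : z h = z h0 * c'.
  apply: (corr_fun aiT z0 (corr_f h H'h (lcle_refl v h))).
  by rewrite efh; apply: corrM.
have [k [u [_ Tu [C [m [_ ec']]]]]] := corr_cover (alg_independent_nz aiT) z0 cc'.
have zu0 i : (z \o u) i != 0 by apply: z0; apply: Tu.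
have [aiU irrU copU] := goodHt; have U0 := alg_independent_nz aiU.
have Uf g : Ht g -> LR f Ht (f g) by move=> /irrU [].
have prime_U := irreducible_qprime_in ufd aiU (fun g h => h) (irrU _ hth0).
have UC : LR f Ht (mmap iR (z \o u) C).
  by apply: laurent_mmap => // i; apply: Uf; apply: hts; apply: Tu.
have Hhth : Ht (h + t) by apply: htD; apply: hD0; [exact: H'Ht|exact: lcle_refl].
have Um : LR f Ht (mmap1 (z \o u) m).
  by apply: laurent_mmap1 => // i; apply: Uf; apply: hts; apply: Tu.
have nodiv g : Ht (g + t) -> g <> h0 -> ~ dvd_in (LR f Ht) (f (h0 + t)) (f (g + t)).
  move=> Hg gh0 dg; have [|_ [_ cop]] := copU _ _ hth0 Hg; first by move=> /addIr /esym.
  apply: nut; apply: cop => //; first exact: Uf.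
  by exists 1; split; [exact: laurent1|rewrite mulr1].
(* The denominator is a product of values at points [u i + t]. If the prime [f (h0 + t)] divided one
   of them, or [f (h + t)], coprimeness on [Ht] would make it a unit. *)
have e : z h * mmap1 (z \o u) m = z h0 * mmap iR (z \o u) C.
  by rewrite ezh ec' -mulrA lpevalK.
have [_ _ pp] := prime_U.
have [d|] := pp _ _ _ (Uf _ Hhth) Um UC e.
  by apply: (nodiv h) d => //; case: H'h.
move=> /(qprime_in_mmap1 U0 prime_U) [i|d|[i d]].
- by apply: Uf; apply: hts; apply: Tu.
- by apply: nut; apply: (dvd_in1_unit _ d); apply: Uf.
apply: (nodiv (u i)) d; first by apply: hts; apply: Tu.
by move=> e'; have /bdH' [[]|] := sT _ (Tu i) => //; rewrite e' => e0; exact: h0w0.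
Qed.
Let H'Ht g : H' g -> Ht g.
Proof. by case=> /HHt. Qed.

Let X0 : f h0 != 0.
Proof. by apply: orbit_neq0; apply: HHt. Qed.

Let BX : B (f h0).
Proof. by case: prime_X. Qed.

Let A_sub a : A a -> exists k, B (a * f h0 ^+ k).
Proof.
have var g : init_boundary v H g -> g <> h0 -> init_boundary v H' g.
  by move=> bg gh0; apply/bdH'; left.
move: a; apply: (laurent_ind A0) => [r|g bg|g bg|a b _ _ [k Ba] [l Bb]|a b _ _ [k Ba] [l Bb]].
- by exists 0%N; rewrite mulr1; apply: laurentC.
- exists 0%N; rewrite mulr1; case: (classic (g = h0)) => [->|gh0]; first exact: BX.
  by apply: laurentV => //; apply: var.
- case: (classic (g = h0)) => [->|gh0].
    by exists 1%N; rewrite expr1 mulVf //; apply: laurent1.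
  by exists 0%N; rewrite mulr1; apply: laurentI => //; apply: var.
- exists (k + l)%N; rewrite mulrDl; apply: laurentD => //.
    by rewrite exprD mulrA; apply: laurentM => //; apply: laurentX.
  by rewrite addnC exprD mulrA; apply: laurentM => //; apply: laurentX.
by exists (k + l)%N; rewrite exprD mulrACA; apply: laurentM.
Qed.

Let AW : A (f w0).
Proof.
case: goodH => _ irr _; by case: (irr w0 (removal_new uH Hh0)).
Qed.

Let W0 : f w0 != 0.
Proof. by apply: B0; apply/bdH'; right. Qed.

Let B_sub b : B b -> exists k, A (b * f w0 ^+ k).
Proof.
move: b; apply: (laurent_ind B0) => [r|g bg|g bg|a b _ _ [k Ba] [l Bb]|a b _ _ [k Ba] [l Bb]].
- by exists 0%N; rewrite mulr1; apply: laurentC.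
- exists 0%N; rewrite mulr1; case/bdH': bg => [[bg _]|->]; last exact: AW.
  exact: laurentV.
- case/bdH': bg => [[bg _]|->].
    by exists 0%N; rewrite mulr1; apply: laurentI.
  by exists 1%N; rewrite expr1 mulVf //; apply: laurent1.
- exists (k + l)%N; rewrite mulrDl; apply: laurentD => //.
    by rewrite exprD mulrA; apply: laurentM => //; apply: laurentX.
  by rewrite addnC exprD mulrA; apply: laurentM => //; apply: laurentX.
by exists (k + l)%N; rewrite exprD mulrACA; apply: laurentM.
Qed.

(** The two claims need a common induction. Non-divisibility at the [h + v i] keeps X out of the
    denominator of the equation, so powers of X cancel and [f h] is Laurent; Laurentness at and
    below [h] then gives non-divisibility at [h]. *)
Lemma step_laurent h : H' h -> B (f h) /\ ~ dvd_in B (f h0) (f h).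
Proof.
move=> H'h; have Hth := H'Ht H'h; move: h Hth H'h.
apply: (lcr_ind v_indep lcHt) => h Hth IH H'h.
suff Bh : B (f h).
  split=> //; apply: step_not_dvd => // h' H'h' h'h.
  by have [->//|h'nh] := classic (h' = h); apply: (IH h' (H'Ht H'h') h'h h'nh H'h').1.
case: (classic (init_boundary v H' h)) => bh; first exact: laurentV.
have H'i := not_boundaryP H'h bh.
have IHi i : B (f (h + v i)) /\ ~ dvd_in B (f h0) (f (h + v i)).
  by apply: IH => //; [exact: H'Ht|exact: lcle_var|exact: add_var_neq].
have [_ irr _] := goodH; have [Afh _] := irr h H'h.1.
have [k Bk] := A_sub Afh.
have f0 i : f (h + v i) != 0 by apply: orbit_neq0; apply: H'Ht.
have e : f h * mmap1 (fun i => f (h + v i)) mP = mmap iR (fun i => f (h + v i)) P.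
  by rewrite (orbit_eq (fun i => H'Ht (H'i i))) lpevalK.
have Bw : B (mmap1 (fun i => f (h + v i)) mP) by apply: laurent_mmap1 => // i; case: (IHi i).
have BP : B (mmap iR (fun i => f (h + v i)) P) by apply: laurent_mmap => // i; case: (IHi i).
have [||d Bd ed] :=
  @qprime_in_cancel _ _ iota _ f _ B0 _ _ k (f h * f h0 ^+ k) _ prime_X _ Bw Bk BP.
- move=> /(qprime_in_mmap1 B0 prime_X) [i|d1|[i di]]; first by case: (IHi i).
    by case: (IHi ord_max) => Bi []; apply: dvd_in_trans1.
  by case: (IHi i).
- by rewrite mulrAC e mulrC.
have -> : f h = d by apply: (mulIf (_ : f h0 ^+ k != 0)); rewrite ?expf_neq0 // ed mulrC.
exact: Bd.
Qed.

Let prime_W : qprime_in A (f w0).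
Proof.
case: goodH => _ irr _; apply: (irreducible_qprime_in ufd aiA (fun g b => b)).
apply: irr; exact: removal_new uH Hh0.
Qed.

Let unit_W : unit_in B (f w0).
Proof. by apply: unit_in_var => //; apply/bdH'; right. Qed.

(* A divisor [c] of [f h] in [B] which is a unit of [A] up to powers of [f w0]
   is a unit of [B] up to powers of [f h0], and no such power can occur. *)
Let unit_descent h c c2 i j : H' h -> B c -> dvd_in B c (f h) ->
  c * f w0 ^+ i = c2 * f w0 ^+ j -> unit_in A c2 -> unit_in B c.
Proof.
move=> H'h Bc [d [Bd efh]] ec uc2.
have [Bfh ndiv] := step_laurent H'h.
have [Ac2 [c3 [Ac3 c23]]] := uc2.
have [k Bk] := A_sub Ac2; have [l Bl] := A_sub Ac3.
(* Powers of X bring [c2] and its inverse [c3] into [B], where their product is a power of the prime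
   X; so [c2 * f h0 ^+ k] is a unit of [B] times a power [p] of X. *)
have e1 : 1 * f h0 ^+ (k + l) = (c2 * f h0 ^+ k) * (c3 * f h0 ^+ l).
  by rewrite mulrACA c23 exprD.
have [e2 [e3 [p [p' [Be2 Be3 ee2 _ e23]]]]] :=
  qprime_in_split B0 prime_X (laurent1 iota B0) Bk Bl e1.
have ue2 : unit_in B e2 by split=> //; exists e3.
have e : c * f w0 ^+ i * f h0 ^+ k = e2 * f w0 ^+ j * f h0 ^+ p.
  by rewrite ec mulrAC ee2 mulrAC.
have uWi := unit_inX B0 i unit_W; have uWj := unit_inX B0 j unit_W.
have ue := unit_inM B0 ue2 uWj.
have BcW : B (c * f w0 ^+ i) by apply: laurentM => //; case: uWi.
have Xk m : f h0 ^+ m != 0 by rewrite expf_neq0.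
(* If [p < k], X divides a unit and hence [f h]; if [k < p], X divides [c] and hence [f h]. Both are
   excluded. *)
case: (ltngtP p k) => pk.
- case: ndiv; have e' : c * f w0 ^+ i * f h0 ^+ (k - p).-1 * f h0 = e2 * f w0 ^+ j.
    apply: (mulIf (Xk p)); rewrite -e -!mulrA -exprS -exprD; congr (_ * (_ * _ ^+ _)); lia.
  apply: unit_in_dvd => //.
  apply: (unit_in_dvdl B0 (b := c * f w0 ^+ i * f h0 ^+ (k - p).-1)) => //.
    by apply: laurentM => //; apply: laurentX.
  by rewrite mulrC e'.
- case: ndiv; have e' : c * f w0 ^+ i = f h0 * (e2 * f w0 ^+ j * f h0 ^+ (p - k).-1).
    apply: (mulIf (Xk k)); rewrite e.
    have -> : f h0 ^+ p = f h0 * f h0 ^+ (p - k).-1 * f h0 ^+ k.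
      by rewrite -exprS -exprD; congr (_ ^+ _); lia.
    by ring.
  have [BV _] := unit_inV uWi.
  exists (e2 * f w0 ^+ j * f h0 ^+ (p - k).-1 * (f w0 ^+ i)^-1 * d); split.
    do 2![apply: laurentM => //]; apply: laurentM => //; [by case: ue|exact: laurentX].
  by rewrite efh !mulrA; rewrite !mulrA in e'; rewrite -e' mulfK ?expf_neq0.
apply: (unit_in_dvdl B0 Bc (b := f w0 ^+ i)); first by case: uWi.
suff -> : c * f w0 ^+ i = e2 * f w0 ^+ j by [].
by apply: (mulIf (Xk k)); rewrite e pk.
Qed.

(** Powers of W move divisors from [B] to [A], and [qprime_in_split] strips them again; the property
    in [A] yields a unit there, and [unit_descent] returns to [B]. *)
Lemma step_good : good f H'.
Proof.
split=> // [h H'h|h1 h2 H'h1 H'h2 h12].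
  have [Bfh _] := step_laurent H'h; split=> //.
  split; first by apply: orbit_neq0; apply: H'Ht.
  move=> b c Bb Bc e; have [i Abi] := B_sub Bb; have [j Acj] := B_sub Bc.
  have [_ irr _] := goodH; have [Afh [_ irrh]] := irr h H'h.1.
  have e1 : f h * f w0 ^+ (i + j) = (b * f w0 ^+ i) * (c * f w0 ^+ j).
    by rewrite e exprD mulrACA.
  have [b2 [c2 [i' [j' [Ab2 Ac2 eb ec efh]]]]] := qprime_in_split A0 prime_W Afh Abi Acj e1.
  have [ub|uc] := irrh _ _ Ab2 Ac2 efh; [left|right].
    by apply: (unit_descent H'h Bb _ eb ub); exists c.
  by apply: (unit_descent H'h Bc _ ec uc); exists b; rewrite mulrC.
have [B1 _] := step_laurent H'h1; have [B2 _] := step_laurent H'h2.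
split=> //; split=> // d Bd [e1 [Be1 ed1]] [e2 [Be2 ed2]].
have [_ irr cop] := goodH.
have [A1 _] := irr _ H'h1.1; have [A2 _] := irr _ H'h2.1.
have [i Adi] := B_sub Bd; have [j1 Aj1] := B_sub Be1; have [j2 Aj2] := B_sub Be2.
have ed1' : f h1 * f w0 ^+ (i + j1) = (d * f w0 ^+ i) * (e1 * f w0 ^+ j1).
  by rewrite ed1 exprD mulrACA.
have ed2' : f h2 * f w0 ^+ (i + j2) = (d * f w0 ^+ i) * (e2 * f w0 ^+ j2).
  by rewrite ed2 exprD mulrACA.
have [d1 [g1 [a1 [b1 [Ad1 Ag1 edd1 _ eh1]]]]] := qprime_in_split A0 prime_W A1 Adi Aj1 ed1'.
have [d2 [g2 [a2 [b2 [Ad2 Ag2 edd2 _ eh2]]]]] := qprime_in_split A0 prime_W A2 Adi Aj2 ed2'.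
have [_ [_ cop12]] := cop _ _ H'h1.1 H'h2.1 h12.
have Wk m : f w0 ^+ m != 0 by rewrite expf_neq0.
(* [d1] and [d2] come from the same [d] and differ by a power of W; the one lacking that power
   divides both values in [A]. *)
case: (leqP a1 a2) => a12.
  have ed12 : d1 = d2 * f w0 ^+ (a2 - a1).
    by apply: (mulIf (Wk a1)); rewrite -edd1 edd2 -mulrA -exprD subnK.
  apply: (unit_descent H'h1 Bd _ edd2); first by exists e1.
  apply: cop12 => //; last by exists g2.
  exists (f w0 ^+ (a2 - a1) * g1); rewrite mulrA -ed12; split=> //.
  by apply: laurentM => //; apply: laurentX.
have ed12 : d2 = d1 * f w0 ^+ (a1 - a2).
  by apply: (mulIf (Wk a2)); rewrite -edd2 edd1 -mulrA -exprD subnK // ltnW.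
apply: (unit_descent H'h1 Bd _ edd1); first by exists e1.
apply: cop12 => //; first by exists g1.
exists (f w0 ^+ (a1 - a2) * g2); rewrite mulrA -ed12; split=> //.
by apply: laurentM => //; apply: laurentX.
Qed.
End Step.

Lemma good_remove (G : L -> Prop) (s : seq L) : upper v G -> (forall g, G g -> Ht g) ->
  (forall g, Ht g -> ~ G g -> g \in s) -> good f G.
Proof.
apply: (remove_ind v_indep (Pr := good f) uHt goodHt).
by move=> {}G h0 uG GHt Gh0 minh0; apply: step_good.
Qed.

(** * Arbitrary domains *)

Section LocalModel.
Variables (H : L -> Prop) (g' : L -> F).
Hypothesis lcH : light_cone_regular v H.
Hypothesis g'_ind : alg_independent_on iota g' (init_boundary v H).
Hypothesis g'_sol : forall h, H h -> ~ init_boundary v H h ->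
  g' h = lpeval iR (fun i => g' (h + v i)) P mP.

(* A finite piece of [H] looks like a piece of a translate of [Ht] with finitely
   many points removed. *)
Lemma local_good (E : seq L) e0 : e0 \in E -> (forall e, e \in E -> H e) ->
  exists T : L -> Prop, [/\ forall g, T g -> init_boundary v H g,
    forall g, g \in E -> init_boundary v H g -> T g,
    forall e, e \in E -> irreducible_in (laurent_ring iota g' T) (g' e) &
    forall e1 e2, e1 \in E -> e2 \in E -> e1 <> e2 ->
      coprime_in (laurent_ring iota g' T) (g' e1) (g' e2)].
Proof.
move=> e0E EH; have uH := lcr_upper lcH.
have [hb Ehb] := lcle_directed E v_gen.
have Hhb : H hb by apply: uH (EH _ e0E) (Ehb _ e0E).
have [[D0 hD0] _] := lcH.2 hb Hhb.
have [t [ht _]] := @deep_nonunit (hb :: D0) hb (mem_head _ _).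
(* Below [hb + t], exactly the points outside the translate of [H] by [t] are discarded, so [G]
   agrees there with that translate. *)
pose G a := Ht a /\ ~ (lcle v (a - t) hb /\ ~ H (a - t)).
have uG : upper v G.
  move=> a b [Ha na] ab; split; first exact: uHt ab.
  have abt : lcle v (a - t) (b - t) by apply/lcle_addr.
  move=> [bh nb]; apply: na; split; first exact: lcle_trans bh.
  by move=> Hat; apply: nb; apply: uH abt.
have [s hs] := lcr_finite (hb + t).
have [aiG irrG copG] : good f G.
  apply: (@good_remove G s) => // [a []//|a Ha nG]; apply: hs => //.
  suff : lcle v (a - t) hb by move=> ah; rewrite -(subrK t a); apply/lcle_addr.
  by apply: NNPP => na; apply: nG; split=> // - [].
have GH g : lcle v g hb -> G (g + t) <-> H g.
  move=> gh; rewrite /G addrK; split=> [[_ ng]|Hg]; first by apply: NNPP => nH; apply: ng.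
  by split=> [|[]//]; apply: ht; rewrite in_cons hD0 ?orbT.
have bdGH g : lcle v g hb -> init_boundary v G (g + t) <-> init_boundary v H g.
  move=> gh; have gih i : lcle v (g + v i) hb by apply: lcle_trans gh; apply: lcle_var.
  split=> [[Gg [i nG]]|[Hg [i nH]]].
    by split; [apply/GH|exists i; rewrite -GH // addrAC].
  by split; [apply/GH|exists i; rewrite addrAC GH].
pose T g := init_boundary v H g /\ lcle v g hb.
pose z g := f (g + t).
pose T1 g := T (g - t).
have T1G g : T1 g -> init_boundary v G g.
  by move=> [bg gh]; rewrite -(subrK t g); apply/bdGH.
have aiT1 := alg_independent_on_sub T1G aiG.
have aiz : alg_independent_on iota z T.
  move=> k u iu Tu p p0; apply: (aiT1 k (fun i => u i + t)).
  - by move=> i j /addIr /iu.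
  - by move=> i; rewrite /T1 addrK.
  by rewrite -[RHS]p0.
have aig' : alg_independent_on iota g' T by apply: alg_independent_on_sub g'_ind => g [].
have LRE : laurent_ring iota f T1 = laurent_ring iota z T.
  apply: functional_extensionality => a; apply: propositional_extensionality; split.
    move=> [k [u [A [m [Tu ->]]]]]; exists k, (fun i => u i - t), A, m; split=> //.
    by apply: lpeval_eq => i; rewrite /= /z subrK.
  move=> [k [u [A [m [Tu ->]]]]]; exists k, (fun i => u i + t), A, m; split=> // i.
  by rewrite /T1 addrK.
have z0 := alg_independent_nz aiz; have g'0 := alg_independent_nz aig'.
have f10 := alg_independent_nz aiT1.
have main g : H g -> lcle v g hb -> laurent_ring iota z T (z g) /\ corr iota z g' T (z g) (g' g).
  move: g; apply: (lcr_ind v_indep lcH) => g Hg IH gh.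
  case: (classic (init_boundary v H g)) => bg.
    by split; [apply: laurentV|apply: corrV].
  have Hi := not_boundaryP Hg bg.
  have gih i : lcle v (g + v i) hb by apply: lcle_trans gh; apply: lcle_var.
  have IHi i : laurent_ring iota z T (z (g + v i)) /\ corr iota z g' T (z (g + v i)) (g' (g + v i)).
    by apply: IH => //; [exact: lcle_var|exact: add_var_neq].
  have Hti i : Ht (g + v i + t) by have [] : G (g + v i + t) by apply/GH.
  have zi0 i : z (g + v i) != 0 by apply: orbit_neq0.
  have ez : z g = lpeval iR (fun i => z (g + v i)) P mP.
    rewrite /z orbit_eq => [|i]; last by rewrite addrAC.
    by apply: lpeval_eq => i; rewrite addrAC.
  have Lz : laurent_ring iota z T (z g).
    (* [f (g + t)] is known to be Laurent over the whole boundary of [G]; being a quotient of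
       elements over [T1], it lies in the smaller ring. *)
    rewrite -LRE; apply: (laurent_div aiG T1G
      (b := mmap1 (fun i => z (g + v i)) mP) (c := mmap iR (fun i => z (g + v i)) P)).
    - by apply: laurent_mmap1 => // i; rewrite LRE; case: (IHi i).
    - by apply: laurent_mmap => // i; rewrite LRE; case: (IHi i).
    - exact: mmap1_neq0.
    - by have [] := irrG (g + t) (proj2 (GH g gh) Hg).
    by rewrite ez lpevalK.
  split=> //; have [b zb] := corr_total g' Lz.
  suff -> : g' g = b by [].
  rewrite (g'_sol Hg bg); apply/esym; apply: (corr_mmap_eq aiz g'0 _ zb _ _ ez) => // i.
    by case: (IHi i).
  apply: contraNneq (zi0 i) => gi; apply/eqP; have [_] := IHi i; rewrite gi => /corr_sym.
  exact: corr_zero.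
have EGT e : e \in E ->
    [/\ G (e + t), laurent_ring iota f T1 (z e) & corr iota z g' T (z e) (g' e)].
  move=> eE; have [Lz cz] := main e (EH _ eE) (Ehb _ eE).
  by rewrite LRE; split=> //; apply/GH; [apply: Ehb|apply: EH].
exists T; split=> [g []//|g gE bg|e eE|e1 e2 e1E e2E e12].
- by split=> //; apply: Ehb.
- have [Ge Le ce] := EGT e eE; apply: (irreducible_in_corr aiz aig' ce).
  by rewrite -LRE; apply: (irreducible_in_restrict aiG T1G Le); apply: irrG.
have [Ge1 Le1 ce1] := EGT e1 e1E; have [Ge2 Le2 ce2] := EGT e2 e2E.
apply: (coprime_in_corr aiz aig' ce1 ce2); rewrite -LRE.
apply: (coprime_in_restrict aiG T1G Le1 Le2); apply: copG => //.
by move=> /addIr.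
Qed.
End LocalModel.
End Orbit.

Theorem theorem1p18
  (R : idomainType) (L : zmodType) (n : nat) (v : 'I_n.+1 -> L)
  (P : {mpoly R[n.+1]}) (mP : 'X_{1..n.+1})
  (Q : {mpoly R[n.+1]}) (mQ : 'X_{1..n.+1})
  (F : fieldType) (iota : {rmorphism {fraction R} -> F}) (x : L -> F)
  (Ht : L -> Prop) :
  UFD R ->
  injective v -> generates v -> nonneg_independent v ->
  Phi_hyps P mP ->
  (lcle v (v ord_max) 0 /\ forall i, lcle v (v ord_max) (v i)) ->
  Psi_hyps P mP Q mQ ->
  alg_independent iota x ->
  light_cone_regular v Ht ->
  laurent_property iota x v P mP Ht ->
  irreducibility iota x v P mP Ht ->
  coprimeness iota x v P mP Ht ->
  forall H : L -> Prop, light_cone_regular v H ->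
    laurent_property iota x v P mP H /\
    irreducibility iota x v P mP H /\
    coprimeness iota x v P mP H.
Proof.
move=> ufd v_inj v_gen v_indep PhiH [_ v_min] PsiH aix lcHt _ irrHt copHt H lcH.
have [f fsol] := solution_exists iota P mP v_indep x lcHt.
have LRx K g : is_solution iota x v P mP K g ->
    laurent_ring iota x (init_boundary v K) = laurent_ring iota g (init_boundary v K).
  move=> [gx _]; apply: functional_extensionality => a; apply: propositional_extensionality.
  by split; apply: laurent_eq => h /gx.
have AIx K g : is_solution iota x v P mP K g -> alg_independent_on iota g (init_boundary v K).
  move=> [gx _]; apply: alg_independent_on_eq (alg_independent_on_all aix) => h /gx.
  by move=> ->.
have goodHt : good iota v f Ht.
  by rewrite /good -LRx //; split; [exact: AIx|exact: irrHt|exact: copHt].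
have local g (gsol : is_solution iota x v P mP H g) := local_good ufd v_inj v_gen v_indep
  v_min PhiH PsiH lcHt fsol.2 goodHt lcH (AIx H g gsol) gsol.2.
have up g (T : L -> Prop) u : (forall h, T h -> init_boundary v H h) ->
    unit_in (laurent_ring iota g T) u -> unit_in (laurent_ring iota g (init_boundary v H)) u.
  move=> TH [Tu [w [Tw uw]]]; split; first exact: laurent_sub Tu.
  by exists w; split=> //; apply: laurent_sub Tw.
have inT g (T : L -> Prop) (s : seq L) a : (forall h, h \in s -> init_boundary v H h) ->
    (forall h, h \in s -> init_boundary v H h -> T h) ->
    laurent_ring iota g (fun h => h \in s) a -> laurent_ring iota g T a.
  by move=> sH sT; apply: laurent_sub => h hs; apply: sT => //; apply: sH.
have lau g : is_solution iota x v P mP H g -> forall h, H h ->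
    laurent_ring iota g (init_boundary v H) (g h) /\ g h != 0.
  move=> gsol h Hh; have [|T [TH _ irr _]] := local g gsol [:: h] h (mem_head _ _).
    by move=> e; rewrite inE => /eqP ->.
  have [Th [h0 _]] := irr h (mem_head _ _); split=> //; exact: laurent_sub Th.
split; last split.
- by move=> g gsol h Hh; rewrite (LRx H g gsol); case: (lau g gsol h Hh).
- move=> g gsol h Hh; rewrite (LRx H g gsol); have [Lh h0] := lau g gsol h Hh.
  split=> //; split=> // b c Lb Lc e.
  (* A factorization involves finitely many variables. Adding them to the list of points puts both
     factors into the ring over [T], where [g h] is irreducible, and units over [T] remain units. *)
  have [sb sbH Lb'] := laurent_finite Lb; have [sc scH Lc'] := laurent_finite Lc.
  have [|T [TH ET irr _]] := local g gsol (h :: sb ++ sc) h (mem_head _ _).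
    by move=> a; rewrite inE mem_cat => /or3P [/eqP ->|/sbH []|/scH []].
  have [_ [_ /(_ b c)]] := irr h (mem_head _ _); case.
  + by apply: inT Lb' => // a ab; apply: ET; rewrite in_cons mem_cat ab orbT.
  + by apply: inT Lc' => // a ab; apply: ET; rewrite in_cons mem_cat ab !orbT.
  + exact: e.
  + by move=> /up; left; auto.
  + by move=> /up; right; auto.
move=> g gsol h1 h2 Hh1 Hh2 h12; rewrite (LRx H g gsol).
have [L1 _] := lau g gsol h1 Hh1; have [L2 _] := lau g gsol h2 Hh2.
split=> //; split=> // d Ld [e1 [Le1 ed1]] [e2 [Le2 ed2]].
have [sd sdH Ld'] := laurent_finite Ld.
have [s1 s1H L1'] := laurent_finite Le1; have [s2 s2H L2'] := laurent_finite Le2.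
pose E := h1 :: h2 :: sd ++ s1 ++ s2.
have [|T [TH ET _ cop]] := local g gsol E h1 (mem_head _ _).
  by move=> a; rewrite !inE !mem_cat => /or4P [/eqP ->|/eqP ->|/sdH []|/orP [/s1H []|/s2H []]].
have h2E : h2 \in E by rewrite /E !inE eqxx orbT.
have [_ [_ copT]] := cop h1 h2 (mem_head _ _) h2E h12.
apply: (up g T) => //; apply: copT.
- by apply: inT Ld' => // a ab; apply: ET; rewrite /E !in_cons !mem_cat ab !orbT.
- exists e1; split=> //; apply: inT L1' => // a ab; apply: ET.
  by rewrite /E !in_cons !mem_cat ab !orbT.
exists e2; split=> //; apply: inT L2' => // a ab; apply: ET.
by rewrite /E !in_cons !mem_cat ab !orbT.
Qed.
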